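(* Let $Y$ be the bounded strong solution of the call-side obstacle problem and let $A(\tau)=\max\{x:x\le\ln K_1,\ Y(x,\tau)=K_2-k_1\}$, $\tau\in(0,T]$, be its lower free boundary. Then, with $A(0):=\lim_{\tau\searrow0}A(\tau)$, the function $A$ is strictly decreasing and continuous on $[0,T]$, and $$A(0)=\lim_{\tau\searrow0}A(\tau)=\ln K_1.$$
   Context: Constants: $0<K_1<k_1<k_2<K_2$, $\sigma>0$, $r>0$, $q\ge0$, $T>0$. Put $\mathcal Lu:=\frac{\sigma^2}{2}\partial_{xx}u+\left(r-q-\frac{\sigma^2}{2}\right)\partial_xu-ru$ and $\psi_1(x):=(e^x-K_1)^++K_2-k_1$. Let $Q=(-\infty,\ln k_1)\times(0,T]$. For $1<p<\infty$, $\mathcal W_p(Q)$ is the set of $u\in C((-\infty,\ln k_1]\times[0,T])$ such that, for all $R,\rho>0$, $u,\partial_xu,\partial_{xx}u,\partial_\tau u$ (weak derivatives) belong to $L^p$ of $\left(((-\infty,\ln k_1)\cap(-R,R))\times(0,T)\right)\setminus B_\rho(\ln K_1,0)$, where $B_\rho$ denotes an open disc of radius $\rho$. A strong solution of the call-side obstacle problem is a function $Y\in\mathcal W_p(Q)$ with $Y\ge\psi_1$ in $Q$, $\partial_\tau Y-\mathcal LY\ge0$ almost everywhere in $Q$, $\partial_\tau Y-\mathcal LY=0$ almost everywhere on $\{Y>\psi_1\}$, $Y(x,0)=\psi_1(x)$ for $x<\ln k_1$, and $Y(\ln k_1,\tau)=K_2-K_1$ for $\tau\in[0,T]$. For every $1<p<\infty$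 there is exactly one bounded strong solution, and it does not depend on $p$. For each $\tau\in(0,T]$ the set $\{x\le\ln K_1:Y(x,\tau)=K_2-k_1\}$ is a nonempty closed half line $(-\infty,A(\tau)]$ with $A(\tau)<\ln K_1$. *)

(* Defs.v *)
From HB Require Import structures.
From mathcomp Require Import all_boot all_order all_algebra.
From mathcomp Require Import all_classical all_reals all_analysis.

Set Implicit Arguments.
Unset Strict Implicit.
Unset Printing Implicit Defensive.

Import Order.TTheory GRing.Theory Num.Theory.
Import numFieldNormedType.Exports.

Local Open Scope classical_set_scope.
Local Open Scope ring_scope.

(* Points of the plane are pairs z = (x, tau). *)

Definition lebesgue2 (R : realType) :
    {measure set (measurableTypeR R * measurableTypeR R) -> \bar R} :=
  (@lebesgue_measure R \x @lebesgue_measure R)%E.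

Definition e_x (R : realType) : R * R := (1, 0).
Definition e_tau (R : realType) : R * R := (0, 1).

(* Iterated classical partial derivative; the word s lists the variables
   (true for x, false for tau), the innermost derivative being the last one. *)
Definition iter_partial (R : realType) (s : seq bool) (phi : R * R -> R) :
    R * R -> R :=
  foldr (fun (b : bool) (g : R * R -> R) =>
           'D_(if b then e_x R else e_tau R) g) phi s.

(* C^oo on the plane: all iterated partial derivatives exist and are
   continuous. *)
Definition smooth (R : realType) (phi : R * R -> R) : Prop :=
  forall s : seq bool,
    continuous (iter_partial s phi) /\
    (forall z, derivable (iter_partial s phi) z (e_x R) /\
               derivable (iter_partial s phi) z (e_tau R)).

Definition test_function (R : realType) (U : set (R * R))
    (phi : R * R -> R) : Prop :=
  smooth phi /\
  exists K : set (R * R),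
    [/\ compact K, K `<=` U & forall z, ~ K z -> phi z = 0].

Definition loc_integrable (R : realType) (U : set (R * R))
    (f : R * R -> R) : Prop :=
  forall K : set (R * R), compact K -> K `<=` U ->
    (lebesgue2 R).-integrable K (EFin \o f).

(* g is the weak derivative of f in the direction v on the open set U. *)
Definition weak_derivative (R : realType) (U : set (R * R)) (v : R * R)
    (f g : R * R -> R) : Prop :=
  [/\ loc_integrable U f, loc_integrable U g &
      forall phi, test_function U phi ->
        \int[lebesgue2 R]_(z in U) (f z * 'D_v phi z)
        = - \int[lebesgue2 R]_(z in U) (g z * phi z)].

Definition in_Lp (R : realType) (p : R) (D : set (R * R))
    (f : R * R -> R) : Prop :=
  f \_ D \in Lfun (lebesgue2 R) p%:E.

Definition Qdom (R : realType) (k1 T : R) : set (R * R) :=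
  `]-oo, ln k1[ `*` `]0, T].

Definition Qint (R : realType) (k1 T : R) : set (R * R) :=
  `]-oo, ln k1[ `*` `]0, T[.

Definition Qclosed (R : realType) (k1 T : R) : set (R * R) :=
  `]-oo, ln k1] `*` `[0, T].

(* Open Euclidean disc (the library's [ball] on R * R is a square). *)
Definition disc (R : realType) (c : R * R) (rho : R) : set (R * R) :=
  [set z | (z.1 - c.1) ^+ 2 + (z.2 - c.2) ^+ 2 < rho ^+ 2].

Definition Qtrunc (R : realType) (K1 k1 T a rho : R) : set (R * R) :=
  ((`]-oo, ln k1[ `&` `]- a, a[) `*` `]0, T[) `\` disc (ln K1, 0) rho.

(* u is in W_p(Q), and ux, uxx, ut represent its weak derivatives.  Weak
   derivatives are taken on the interior of Q, which is the increasing union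
   of the interiors of the sets Qtrunc, the centre of the discs being outside
   the interior of Q. *)
Definition Wp_derivatives (R : realType) (K1 k1 T p : R)
    (u ux uxx ut : R * R -> R) : Prop :=
  [/\ {within Qclosed k1 T, continuous u},
      weak_derivative (Qint k1 T) (e_x R) u ux,
      weak_derivative (Qint k1 T) (e_x R) ux uxx,
      weak_derivative (Qint k1 T) (e_tau R) u ut &
      forall a rho : R, 0 < a -> 0 < rho ->
        [/\ in_Lp p (Qtrunc K1 k1 T a rho) u,
            in_Lp p (Qtrunc K1 k1 T a rho) ux,
            in_Lp p (Qtrunc K1 k1 T a rho) uxx &
            in_Lp p (Qtrunc K1 k1 T a rho) ut]].

(* The operator L, applied to the values of u, u_x and u_xx at a point. *)
Definition Lop (R : realType) (sigma r q : R) (v vx vxx : R) : R :=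
  sigma ^+ 2 / 2 * vxx + (r - q - sigma ^+ 2 / 2) * vx - r * v.

Definition psi1 (R : realType) (K1 k1 K2 : R) (x : R) : R :=
  Num.max (expR x - K1) 0 + K2 - k1.

Definition strong_solution (R : realType) (K1 k1 K2 sigma r q T p : R)
    (Y : R * R -> R) : Prop :=
  exists Yx Yxx Yt : R * R -> R,
    Wp_derivatives K1 k1 T p Y Yx Yxx Yt /\
    [/\ forall z, Qdom k1 T z -> psi1 K1 k1 K2 z.1 <= Y z,
        {ae lebesgue2 R, forall z, Qdom k1 T z ->
           0 <= Yt z - Lop sigma r q (Y z) (Yx z) (Yxx z)},
        {ae lebesgue2 R, forall z, Qdom k1 T z -> psi1 K1 k1 K2 z.1 < Y z ->
           Yt z - Lop sigma r q (Y z) (Yx z) (Yxx z) = 0},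
        forall x, x < ln k1 -> Y (x, 0) = psi1 K1 k1 K2 x &
        forall tau, 0 <= tau <= T -> Y (ln k1, tau) = K2 - K1].

Definition bounded_solution (R : realType) (k1 T : R)
    (Y : R * R -> R) : Prop :=
  exists M : R, forall z, Qclosed k1 T z -> `|Y z| <= M.

Definition is_max (R : realType) (S : set R) (m : R) : Prop :=
  S m /\ ubound S m.

Definition lower_contact_set (R : realType) (K1 k1 K2 : R)
    (Y : R * R -> R) (tau : R) : set R :=
  [set x | x <= ln K1 /\ Y (x, tau) = K2 - k1].

(* Main.v *)
Require Import Defs.
From mathcomp Require Import all_boot all_order all_algebra.
From mathcomp Require Import all_classical all_reals all_analysis.
From mathcomp Require Import measurable_realfun.
From mathcomp Require Import ring lra.
Set Implicit Arguments.
Unset Strict Implicit.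
Unset Printing Implicit Defensive.
Import Order.TTheory GRing.Theory Num.Theory.
Import numFieldNormedType.Exports.
Local Open Scope classical_set_scope.
Local Open Scope ring_scope.

(* The operator has constant coefficients, so mollifying a strong solution
   yields classical functions satisfying the same differential inequality;
   averaging over the past only makes this work up to the final time.  Hence
   solutions, and differences of their translates, obey a comparison principle
   against explicit classical barriers, whatever p is.  Comparing the solution
   with its translates shows that it is nondecreasing in x and in tau, so the
   contact set is a half line and A is nonincreasing.  On the contact set the
   constant obstacle c = K2 - k1 is a strict supersolution (c r > 0), so a
   contact interval cannot be left instantaneously: this gives A(0+) = ln K1
   and right continuity, while left continuity is closedness of the contact
   set.  The solution is a supersolution above the obstacle, so it has no convex
   kink at a contact point; in particular it lies above c at ln K1.  If A were
   constant on [s, t], the increment Y(., tau + h) - Y(., tau) would be positive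
   at ln K1 (positivity spreads forward from tau = 0), so it would grow linearly
   away from the boundary by Hopf's lemma, and Y would have a convex kink. *)

(** * Compactly supported smooth functions *)

(** The solution has only weak second derivatives, so neither the maximum principle nor a barrier
    can be evaluated on it pointwise. [heat_approx] therefore asks for classical functions,
    uniformly close near the point, that satisfy the differential relation exactly. This form passes
    directly to translates and differences. That is what makes translates comparable: where the
    solution exceeds its translate by a nonnegative shift it also exceeds the obstacle, so there it
    solves the equation while the translate is a supersolution. Looking only into the past is forced
    by the final time, since weak derivatives live on the open strip while the conclusion reaches T;
    it suffices because at a maximum over past times the time derivative still has a sign. The test
    functions are built from exp(-1/x): multiplied by polynomials in 1/x it generates a class closed
    under differentiation, so smoothness is an induction. *)

Lemma is_derive_quadratic_error (R : realType) (f : R -> R) (x df C : R) :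
  (forall h, `|h| <= 1 -> `|f (h + x) - f x - h * df| <= C * h ^+ 2) ->
  is_derive x 1 f df.
Proof.
move=> H.
have cv : (fun h => h^-1 *: (f (h *: 1 + x) - f x)) @ 0^' --> df.
  apply/cvgrPdist_le => e e0.
  exists (Num.min 1 (e / (`|C| + 1))) => /=.
    by rewrite lt_min ltr01 divr_gt0// ltr_wpDl.
  move=> h /=; rewrite sub0r normrN lt_min => /andP[h1 he] h0.
  have -> : df - h^-1 *: (f (h *: 1 + x) - f x)
    = - (h^-1 * (f (h + x) - f x - h * df)).
    rewrite scalerBr /GRing.scale/= mulr1 -[X in - X]mulr1; field.
    exact: h0.
  rewrite normrN normrM normfV.
  rewrite mulrC ler_pdivrMr ?normr_gt0//.
  apply: (le_trans (H _ (ltW h1))).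
  rewrite -[h ^+ 2]ger0_norm ?sqr_ge0// normrX expr2 mulrA ler_wpM2r//.
  apply: (@le_trans _ _ ((`|C| + 1) * `|h|)).
    by rewrite ler_wpM2r// (le_trans (ler_norm C))// lerDl.
  by rewrite mulrC -ler_pdivlMr ?ltr_wpDl// ltW.
apply: DeriveDef; first by apply/cvg_ex; exists df.
exact/cvg_lim.
Qed.

(** The function p(1/x) exp(-1/x), extended by 0. Carrying the polynomial keeps the class closed
    under differentiation: the derivative replaces p by X^2 (p - p'). *)
Definition flat (R : realType) (p : {poly R}) (x : R) : R :=
  if 0 < x then p.[x^-1] * expR (- x^-1) else 0.

(** With y = 1/x >= 1 the polynomial is at most S y^n, and y^(n+1) / (n+1)! <= exp y leaves one
    spare factor x. *)
Lemma flat_bound (R : realType) (p : {poly R}) :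
  exists C, forall x, x <= 1 -> `|flat p x| <= C * `|x|.
Proof.
pose n := size p.
pose S := \sum_(i < size p) `|p`_i|.
have S0 : 0 <= S by apply: sumr_ge0.
exists (S * n.+1`!%:R) => x x1; rewrite /flat; case: ifPn => x0; last first.
  by rewrite normr0 !mulr_ge0.
set y := x^-1.
have y1 : 1 <= y by rewrite /y invr_ge1// ?x1// unitfE gt_eqF.
have y0 : 0 < y by apply: lt_le_trans y1.
rewrite normrM [X in _ * X]ger0_norm ?expR_ge0// expRN.
rewrite ler_pdivrMr ?expR_gt0//.
have Hp : `|p.[y]| <= S * y ^+ n.
  rewrite horner_coef (le_trans (ler_norm_sum _ _ _))// /S mulr_suml.
  apply: ler_sum => i _; rewrite normrM ler_wpM2l//.
  rewrite normrX (ger0_norm (ltW y0)).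
  by apply: ler_weXn2l => //; exact: ltnW.
apply: (le_trans Hp).
rewrite -!mulrA ler_wpM2l//.
have := expR_ge1Dxn n (ltW y0) => He.
have {}He : y ^+ n.+1 / n.+1`!%:R <= expR y.
  by apply: le_trans He; rewrite lerDr.
rewrite gtr0_norm//.
have f0 : (0:R) < n.+1`!%:R by rewrite ltr0n fact_gt0.
have : x * y ^+ n.+1 <= x * (n.+1`!%:R * expR y).
  by rewrite ler_pM2l// mulrC -ler_pdivrMr.
have xy : x * y = 1 by rewrite mulfV// gt_eqF.
rewrite exprS (mulrA x y) xy mul1r => /le_trans; apply.
by rewrite mulrCA.
Qed.

Lemma is_derive_flat (R : realType) (p : {poly R}) (x : R) :
  is_derive x 1 (flat p) (flat ('X ^+ 2 * (p - p^`())) x).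
Proof.
have [x0|x0|->] := ltgtP x 0.
- rewrite {2}/flat ltNge (ltW x0)/=.
  apply: (@near_eq_is_derive _ _ _ (cst 0)).
  near=> z; rewrite /flat /cst/= ltNge ifF//; apply/negbTE; rewrite negbK.
  by near: z; exact: lt_le_nbhsl.
- rewrite {2}/flat x0.
  apply: (@near_eq_is_derive R R R (fun x => p.[x^-1] * expR (- x^-1))).
    by near=> z; rewrite /flat ifT//; near: z; exact: lt_nbhsr.
  have dV : is_derive x 1 (fun y : R => y^-1) (- x ^- 2).
    have -> : - x ^- 2 = - x ^- 2 *: 1 :> R by rewrite /GRing.scale/= mulr1.
    apply: (@is_deriveV _ id) => //; by rewrite gt_eqF.
  have d1 := is_derive1_comp (is_derive_poly p x^-1) dV.
  have dN := is_deriveN dV.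
  have d2 := @is_derive1_comp R expR (- GRing.inv) x _ _ (is_derive_expR _) dN.
  have d3 := is_deriveM d1 d2.
  apply: is_derive_eq d3 _.
  rewrite /GRing.scale/= !hornerE/=; field.
  by rewrite gt_eqF.
- rewrite {2}/flat ltxx.
  (* Applying the bound to X p instead of p gains another factor x, so [flat p] is O(h^2) at 0 and
     its derivative there is 0. *)
  have [C HC] := flat_bound ('X * p).
  apply: (@is_derive_quadratic_error _ _ _ _ C) => h h1.
  rewrite mulr0 addr0 subr0 {2}/flat ltxx subr0.
  have := HC h (le_trans (ler_norm h) h1).
  rewrite /flat; case: ifPn => h0; last first.
    move=> /(ler_wpM2r (normr_ge0 h)).
    by rewrite normr0 mul0r -mulrA -expr2 real_normK ?num_real.
  move=> /(ler_wpM2r (normr_ge0 h)).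
  rewrite -mulrA -expr2 real_normK ?num_real//; apply: le_trans.
  rewrite !hornerE !normrM normfV -!mulrA.
  have H0 (a b c : R) : c != 0 -> c^-1 * (a * (b * c)) = a * b by move=> ?; field.
  by rewrite H0// normr_eq0 gt_eqF.
Unshelve. all: by end_near. Qed.

(* Finite sums of products [flat p (y - a) * flat q (b - y)]: a class of bumps
   on ]a, b[ that is closed under differentiation. *)
Inductive bump_fun (R : realType) (a b : R) : (R -> R) -> Prop :=
| bump_flat (p q : {poly R}) : bump_fun a b (fun y => flat p (y - a) * flat q (b - y))
| bump_add f g : bump_fun a b f -> bump_fun a b g -> bump_fun a b (fun y => f y + g y).

Lemma bump_derive (R : realType) (a b : R) f : bump_fun a b f ->
  exists2 g, bump_fun a b g & forall y : R, is_derive y 1 f (g y).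
Proof.
elim=> [p q|{}f g _ [f' bf df] _ [g' bg dg]].
  exists (fun y => flat ('X ^+ 2 * (p - p^`())) (y - a) * flat q (b - y) +
       flat p (y - a) * flat (- ('X ^+ 2 * (q - q^`()))) (b - y)).
    by apply: bump_add; exact: bump_flat.
  move=> y.
  have d1 : is_derive y 1 (fun y => y - a) 1.
    by apply: is_derive_eq (is_deriveB (is_derive_id (y : R) (1 : R)) (is_derive_cst a (y : R) (1 : R))) _; rewrite subr0.
  have d2 : is_derive y 1 (fun y => b - y) (-1).
    by apply: is_derive_eq (is_deriveB (is_derive_cst b (y : R) (1 : R)) (is_derive_id (y : R) (1 : R))) _; rewrite sub0r.
  have e1 := @is_derive1_comp R (flat p) (fun y => y - a) y _ _ (is_derive_flat p _) d1.
  have e2 := @is_derive1_comp R (flat q) (fun y => b - y) y _ _ (is_derive_flat q _) d2.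
  apply: is_derive_eq (is_deriveM e1 e2) _.
  have -> z : flat (- ('X ^+ 2 * (q - q^`()))) z = - flat ('X ^+ 2 * (q - q^`())) z.
    by rewrite /flat; case: ifP; rewrite ?oppr0// hornerN mulNr.
  rewrite /GRing.scale/= mulr1; ring.
exists (fun y => f' y + g' y); first exact: bump_add.
by move=> y; exact: is_deriveD.
Qed.

Lemma bump_supp (R : realType) (a b : R) f : bump_fun a b f ->
  forall y, y \notin `[a, b] -> f y = 0.
Proof.
elim=> [p q y|{}f g _ hf _ hg y hy]; last by rewrite hf// hg// addr0.
rewrite in_itv/= negb_and -!ltNge => /orP[h|h]; rewrite /flat.
  by rewrite subr_gt0 ltNge (ltW h) mul0r.
by rewrite [X in _ * X]ifF ?mulr0// subr_gt0 ltNge (ltW h).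
Qed.

Lemma bump_shift (R : realType) (a b : R) f x : bump_fun a b f ->
  bump_fun (a + x) (b + x) (fun y => f (y - x)).
Proof.
elim=> [p q|{}f g _ hf _ hg]; last exact: bump_add.
rewrite (_ : (fun y => _) = (fun y => flat p (y - (a + x)) * flat q ((b + x) - y))).
  exact: bump_flat.
by apply/funext => y; congr (flat _ _ * flat _ _); lra.
Qed.

Lemma bump_continuous (R : realType) (a b : R) f : bump_fun a b f -> continuous f.
Proof.
move=> /bump_derive[g _ dg] y.
by apply/differentiable_continuous/derivable1_diffP; case: (dg y).
Qed.

Lemma bump_bounded (R : realType) (a b : R) f : a <= b -> bump_fun a b f ->
  exists2 C, 0 <= C & forall y, `|f y| <= C.
Proof.
move=> ab bf.
have cf : {within `[a, b], continuous (fun y => `|f y|)}.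
  apply: continuous_subspaceT => y.
  by apply: continuous_comp; [exact: bump_continuous bf y|exact: norm_continuous].
have [c _ hc] := EVT_max ab cf.
exists `|f c| => // y; have [/hc//|yab] := boolP (y \in `[a, b]).
by rewrite (bump_supp bf yab) normr0.
Qed.

Definition bump1 (R : realType) (a b y : R) : R := flat 1 (y - a) * flat 1 (b - y).

Lemma bump1_ge0 (R : realType) (a b y : R) : 0 <= bump1 a b y.
Proof.
by rewrite /bump1 /flat mulr_ge0//; case: ifP => // _; rewrite hornerC mul1r expR_ge0.
Qed.

Lemma bump1_int_gt0 (R : realType) (a b : R) : a < b ->
  (0 < \int[lebesgue_measure]_y (bump1 a b y)%:E)%E.
Proof.
move=> ab.
(* On the middle third both factors are at least exp(-1/d). *)
pose d := (b - a) / 3.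
have d0 : 0 < d by rewrite /d; lra.
pose m := expR (- d^-1) ^+ 2.
pose u := a + d; pose v := b - d.
have m0 : 0 < m by rewrite exprn_gt0// expR_gt0.
have mb : measurable_fun setT (bump1 a b).
  by apply: continuous_measurable_fun; exact: (bump_continuous (@bump_flat R a b 1 1)).
apply: (@lt_le_trans _ _ (\int[lebesgue_measure]_(y in `[u, v]) m%:E)%E).
  rewrite integral_cst//= lebesgue_measure_itv/= lte_fin ifT; last by rewrite /u /v /d; lra.
  by rewrite -EFinB -EFinM lte_fin mulr_gt0// /u /v /d; lra.
apply: (@le_trans _ _ (\int[lebesgue_measure]_(y in `[u, v]) (bump1 a b y)%:E)%E).
  apply: ge0_le_integral => //.
  - by move=> y _; rewrite lee_fin ltW.
  - by apply/measurable_EFinP; apply: measurable_funTS.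
  move=> y /=; rewrite in_itv/= /u /v => /andP[h1 h2].
  have fl z : d <= z -> expR (- d^-1) <= flat 1 z.
    move=> dz; have z0 : 0 < z by apply: lt_le_trans dz.
    by rewrite /flat z0 hornerC mul1r ler_expR lerN2 lef_pV2.
  rewrite lee_fin /bump1 /m expr2 ler_pM ?expR_ge0// fl//; lra.
apply: ge0_subset_integral => //; first exact/measurable_EFinP.
by move=> y _; rewrite lee_fin bump1_ge0.
Qed.

Lemma lebesgue_integral_translation (R : realType) (g : R -> R) (x : R) :
  continuous g -> (forall y, 0 <= g y) ->
  (\int[lebesgue_measure]_y (g (y - x))%:E = \int[lebesgue_measure]_y (g y)%:E)%E.
Proof.
move=> cg g0.
have F'E : derive1 (fun y : R => y - x) = cst 1.
  apply/funext => y; rewrite derive1E.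
  have : is_derive y 1 (fun y : R => y - x) (1 - 0).
    exact: (is_deriveB (is_derive_id (y : R) (1 : R)) (is_derive_cst x (y : R) (1 : R))).
  by rewrite subr0 => -[].
rewrite [RHS](@increasing_ge0_integration_by_substitutionT R (fun y => y - x))//.
- by apply: eq_integral => y _; rewrite F'E/= !fctE mulr1.
- by move=> u v uv; rewrite ltrD2r.
- by rewrite F'E => ?; exact: cvg_cst.
- by rewrite F'E; exact: is_cvg_cst.
- by rewrite F'E; exact: is_cvg_cst.
- exact: cvg_addrr_Ny.
- exact: cvg_addrr.
Qed.

Lemma measurable_bump (R : realType) (a b : R) f : bump_fun a b f ->
  measurable_fun [set: measurableTypeR R] (f : measurableTypeR R -> R).
Proof. by move=> bf; apply: continuous_measurable_fun; exact: bump_continuous bf. Qed.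

Lemma measurable_tensor (R : realType) (a b c d : R) f g : bump_fun a b f -> bump_fun c d g ->
  measurable_fun [set: measurableTypeR R * measurableTypeR R]
    (fun z : measurableTypeR R * measurableTypeR R => f z.1 * g z.2 : R).
Proof.
move=> bf bg; apply: measurable_funM.
  by apply: measurableT_comp (measurable_bump bf) _; exact: measurable_fst.
by apply: measurableT_comp (measurable_bump bg) _; exact: measurable_snd.
Qed.

Lemma continuous_tensor (R : realType) (f g : R -> R) : continuous f -> continuous g ->
  continuous (fun z : R * R => f z.1 * g z.2).
Proof.
move=> cf cg z; apply: continuousM.
  by apply: continuous_comp; [exact: cvg_fst|exact: cf].
by apply: continuous_comp; [exact: cvg_snd|exact: cg].
Qed.

Lemma is_derive_tensor_x (R : realType) (f g : R -> R) (z : R * R) df :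
  is_derive z.1 1 f df -> is_derive z (e_x R) (fun z => f z.1 * g z.2) (df * g z.2).
Proof.
move=> [/cvg_ex[l hl] dfE].
have {}dfE : l = df by rewrite -dfE; exact/esym/cvg_lim.
have cv : (fun h : R => h^-1 *: (f (h *: e_x R + z).1 * g (h *: e_x R + z).2 - f z.1 * g z.2)) @ 0^'
   --> df * g z.2.
  rewrite (_ : (fun h => _) = (fun h => (h^-1 *: (f (h *: 1 + z.1) - f z.1)) * g z.2)).
    by apply: cvgMl; rewrite -dfE.
  apply/funext => h /=.
  by rewrite /GRing.scale/= mulr0 add0r -mulrA mulrBl.
apply: DeriveDef; first by apply/cvg_ex; exists (df * g z.2).
exact/cvg_lim.
Qed.

Lemma is_derive_tensor_tau (R : realType) (f g : R -> R) (z : R * R) dg :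
  is_derive z.2 1 g dg -> is_derive z (e_tau R) (fun z => f z.1 * g z.2) (f z.1 * dg).
Proof.
move=> [/cvg_ex[l hl] dgE].
have {}dgE : l = dg by rewrite -dgE; exact/esym/cvg_lim.
have cv : (fun h : R => h^-1 *: (f (h *: e_tau R + z).1 * g (h *: e_tau R + z).2 - f z.1 * g z.2)) @ 0^'
   --> f z.1 * dg.
  rewrite (_ : (fun h => _) = (fun h => f z.1 * (h^-1 *: (g (h *: 1 + z.2) - g z.2)))).
    by apply: cvgMr; rewrite -dgE.
  apply/funext => h /=.
  by rewrite /GRing.scale/= mulr0 add0r -mulrBr mulrCA.
apply: DeriveDef; first by apply/cvg_ex; exists (f z.1 * dg).
exact/cvg_lim.
Qed.

Lemma tensor_smooth (R : realType) (a b c d : R) f g : bump_fun a b f -> bump_fun c d g ->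
  smooth (fun z => f z.1 * g z.2).
Proof.
move=> bf bg s.
(* Every iterated partial derivative is again a product of two bumps; this is the statement that
   goes through the induction on the word. *)
have [f' [g' [bf' bg' ->]]] : exists f' g', [/\ bump_fun a b f', bump_fun c d g' &
    iter_partial s (fun z => f z.1 * g z.2) = (fun z => f' z.1 * g' z.2)].
  elim: s => [|i s [f' [g' [bf' bg' /= ->]]]]; first by exists f, g.
  case: i.
    have [f2 bf2 df2] := bump_derive bf'.
    exists f2, g'; split=> //; apply/funext => z.
    by case: (is_derive_tensor_x g' (df2 z.1)) => _ <-.
  have [g2 bg2 dg2] := bump_derive bg'.
  exists f', g2; split=> //; apply/funext => z.
  by case: (is_derive_tensor_tau f' (dg2 z.2)) => _ <-.
split; first exact: (continuous_tensor (bump_continuous bf') (bump_continuous bg')).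
move=> z; have [f2 _ df2] := bump_derive bf'; have [g2 _ dg2] := bump_derive bg'.
have [h1 _] := is_derive_tensor_x g' (df2 z.1).
have [h2 _] := is_derive_tensor_tau f' (dg2 z.2).
by split; [exact: h1|exact: h2].
Qed.

(** Membership unfolds to inequalities that [lra] can use; [box_setX] recovers the product form for
    compactness and measurability. *)
Definition box (R : realType) (a b c d : R) : set (R * R) :=
  [set z | (a <= z.1 <= b) && (c <= z.2 <= d)].

Lemma box_setX (R : realType) (a b c d : R) :
  box a b c d = [set` `[a, b]] `*` [set` `[c, d]].
Proof.
apply/seteqP; split => z; rewrite /box/= !in_itv/=; first by move=> /andP[].
by move=> [-> ->].
Qed.

Lemma compact_box (R : realType) (a b c d : R) : compact (box a b c d).
Proof. by rewrite box_setX; apply: compact_setX; exact: segment_compact. Qed.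

Lemma measurable_box (R : realType) (a b c d : R) :
  measurable (box a b c d : set (measurableTypeR R * measurableTypeR R)).
Proof. by rewrite box_setX; apply: measurableX; exact: measurable_itv. Qed.

Lemma tensor_supp (R : realType) (a b c d : R) f g : bump_fun a b f -> bump_fun c d g ->
  forall z, ~ box a b c d z -> f z.1 * g z.2 = 0.
Proof.
move=> bf bg z; rewrite box_setX => /not_andP[|] /= /negP h.
  by rewrite (bump_supp bf h) mul0r.
by rewrite (bump_supp bg h) mulr0.
Qed.

Lemma tensor_test_function (R : realType) (U : set (R * R)) (a b c d : R) f g :
  bump_fun a b f -> bump_fun c d g -> box a b c d `<=` U ->
  test_function U (fun z => f z.1 * g z.2).
Proof.
move=> bf bg sU; split; first exact: tensor_smooth bf bg.
exists (box a b c d); split=> //; first exact: compact_box.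
exact: tensor_supp bf bg.
Qed.

(** The mass of the mollifying kernel does not depend on its centre as long as its support stays in
    [D]; this provides one normalising constant for a whole neighbourhood. *)
Lemma tensor_integral (R : realType) (a b c d x t : R) (D : set (R * R)) :
  a < b -> c < d -> measurable (D : set (measurableTypeR R * measurableTypeR R)) ->
  box (a + x) (b + x) (c + t) (d + t) `<=` D ->
  (\int[lebesgue2 R]_(z in D) (bump1 a b (z.1 - x) * bump1 c d (z.2 - t))%:E =
  (\int[lebesgue_measure]_y (bump1 a b y)%:E) *
  (\int[lebesgue_measure]_y (bump1 c d y)%:E))%E.
Proof.
move=> ab cd mD sD.
have bf := bump_shift x (@bump_flat R a b 1 1).
have bg := bump_shift t (@bump_flat R c d 1 1).
rewrite integral_mkcond (_ : _ \_ D = EFin \o (fun z : measurableTypeR R * measurableTypeR R =>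
    bump1 a b (z.1 - x) * bump1 c d (z.2 - t))); last first.
  apply/funext => z; rewrite patchE; case: ifPn => //= zD.
  rewrite /bump1 (tensor_supp bf bg)// => /sD h.
  by move/negP: zD; apply; exact: mem_set.
rewrite /lebesgue2 fubini_tonelli1//=; last 2 first.
- by apply/measurable_EFinP; exact: (measurable_tensor bf bg).
- by move=> z; rewrite lee_fin mulr_ge0 ?bump1_ge0.
have m1 (u v : R) (w : R) : u < v -> measurable_fun [set: measurableTypeR R] (fun y : measurableTypeR R => bump1 u v (y - w) : R).
  by move=> uv; exact: (measurable_bump (bump_shift w (@bump_flat R u v 1 1))).
have tr (u v w : R) : (\int[lebesgue_measure]_y (bump1 u v (y - w))%:E =
    \int[lebesgue_measure]_y (bump1 u v y)%:E)%E.
  apply: (lebesgue_integral_translation _ _ (g := bump1 u v)); last by move=> ?; exact: bump1_ge0.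
  exact: (bump_continuous (@bump_flat R u v 1 1)).
rewrite /fubini_F/=.
under eq_integral.
  move=> y _.
  under eq_integral do rewrite EFinM.
  rewrite ge0_integralZl//; last 3 first.
  - by apply/measurable_EFinP; exact: m1.
  - by move=> ? _; rewrite lee_fin bump1_ge0.
  - by rewrite lee_fin bump1_ge0.
  rewrite tr.
  over.
rewrite ge0_integralZr//.
- by rewrite tr.
- by apply/measurable_EFinP; exact: m1.
- by move=> ? _; rewrite lee_fin bump1_ge0.
- by apply: integral_ge0 => ? _; rewrite lee_fin bump1_ge0.
Qed.

(** * Mollification *)

Lemma integrable_mul_bounded (R : realType) d (T : measurableType d)
    (mu : {measure set T -> \bar R}) (K : set T) (u h : T -> R) (C : R) :
  measurable K -> mu.-integrable K (EFin \o u) -> measurable_fun K h ->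
  (forall z, `|h z| <= C) -> mu.-integrable K (EFin \o (fun z => u z * h z)).
Proof.
move=> mK iu mh hC.
have -> : EFin \o (fun z => u z * h z) = ((EFin \o u) \* (EFin \o h))%E.
  by apply/funext => z /=; rewrite EFinM.
apply: integrableMl => //.
exists C; split; first exact: num_real.
by move=> x Cx z _ /=; rewrite (le_trans (hC z))// ltW.
Qed.

(** Differentiation falls on the kernel [h] only, so the integrable function [C * |u|] dominates
    uniformly in the parameter. *)
Lemma is_derive_param_integral (R : realType) d (T : measurableType d)
    (mu : {measure set T -> \bar R}) (K : set T) (u : T -> R)
    (h h' : R -> T -> R) (C x : R) :
  measurable K -> mu.-integrable K (EFin \o u) ->
  (forall x, measurable_fun K (h x)) ->
  (forall x z, `|h x z| <= C) -> (forall x z, `|h' x z| <= C) ->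
  (forall x z, is_derive (x : R) 1 (h ^~ z) (h' x z)) ->
  is_derive x 1 (fun x => \int[mu]_(z in K) (u z * h x z))
    (\int[mu]_(z in K) (u z * h' x z)).
Proof.
move=> mK iu mh hC h'C dh.
pose f (x : R) z := u z * h x z.
have df (x1 : R) z : is_derive x1 1 (f ^~ z) (u z * h' x1 z).
  exact: (@is_deriveZ R R R (h ^~ z) (u z) x1 1 (h' x1 z) (dh x1 z)).
have d1f x1 z : partial1of2 f x1 z = u z * h' x1 z.
  by rewrite partial1of2E; case: (df x1 z).
pose I : set R := [set` `]x - 1, x + 1[].
have Ix : I x by rewrite /I/= in_itv/= ltrBlDr ltrDl ltr01.
have intf x1 : I x1 -> mu.-integrable K (EFin \o f x1).
  by move=> _; exact: (integrable_mul_bounded mK iu (mh x1) (hC x1)).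
have derf x1 y : I x1 -> K y -> derivable (f ^~ y) x1 1.
  by move=> _ _; case: (df x1 y).
pose G z := `|u z| * C.
have C0 (z : T) : 0 <= C by apply: le_trans (hC x z).
have G0 z : 0 <= G z by rewrite /G mulr_ge0// (C0 z).
have iG : mu.-integrable K (EFin \o G).
  rewrite (_ : EFin \o G = (fun z => (`|u z|)%:E * C%:E)%E); last first.
    by apply/funext => z; rewrite /G/= EFinM.
  apply: integrableZr => //.
  by have := integrable_abse iu; apply: eq_integrable.
have Gub x1 y : I x1 -> K y -> `|partial1of2 f x1 y| <= G y.
  by move=> _ _; rewrite d1f /G normrM ler_wpM2l.
have cv := cvg_differentiation_under_integral mK Ix intf derf G0 iG Gub.
have E : (fun y => partial1of2 f x y) = (fun z => u z * h' x z).
  by apply/funext => z; rewrite d1f.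
have {}cv : h^-1 *: (\int[mu]_(z in K) f (h *: 1 + x) z - \int[mu]_(z in K) f x z)
    @[h --> 0^'] --> \int[mu]_(z in K) (u z * h' x z).
  by under eq_fun do rewrite scaler1; rewrite -E.
apply: DeriveDef; first by apply/cvg_ex; eexists; exact: cv.
exact/cvg_lim.
Qed.

Lemma lipschitz_of_derive (R : realType) (f f' : R -> R) (C x y : R) :
  (forall x : R, is_derive x 1 f (f' x)) -> (forall x, `|f' x| <= C) ->
  `|f x - f y| <= C * `|x - y|.
Proof.
move=> df f'C; wlog xy : x y / y <= x.
  by move=> W; have [/W//|/ltW/W] := leP y x; rewrite distrC (distrC y).
have cf : {within `[y, x], continuous f}.
  apply: continuous_subspaceT => z.
  by apply/differentiable_continuous/derivable1_diffP; case: (df z).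
have [c _ ->] := MVT_segment xy (fun z _ => df z) cf.
by rewrite normrM ler_wpM2r.
Qed.

(** Bounded partial derivatives give a Lipschitz estimate along each axis; used for the joint
    continuity of mollified functions. *)
Lemma continuous_of_bounded_partials (R : realType) (F Fx Ft : R -> R -> R) (C : R) :
  (forall x t, is_derive (x : R) 1 (F ^~ t) (Fx x t)) ->
  (forall x t, is_derive (t : R) 1 (F x) (Ft x t)) ->
  (forall x t, `|Fx x t| <= C) -> (forall x t, `|Ft x t| <= C) ->
  continuous (fun z : R * R => F z.1 z.2).
Proof.
move=> dx dt Cx Ct [x t]; apply/cvgrPdist_le => e e0 /=.
have C0 : 0 <= C by apply: le_trans (Cx 0 0).
have d0 : 0 < e / (2 * C + 1) by rewrite divr_gt0//; lra.
near=> z.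
have -> : F x t - F z.1 z.2 = (F x t - F z.1 t) + (F z.1 t - F z.1 z.2) by lra.
apply: (le_trans (ler_normD _ _)).
apply: (@le_trans _ _ (C * `|x - z.1| + C * `|t - z.2|)).
  by rewrite lerD// ?(lipschitz_of_derive _ _ (dx^~ _))// ?(lipschitz_of_derive _ _ (dt _)).
have : `|x - z.1| < e / (2 * C + 1) /\ `|t - z.2| < e / (2 * C + 1).
  near: z; exists (ball x (e / (2 * C + 1)), ball t (e / (2 * C + 1))).
    by split; exact: nbhsx_ballx.
  by move=> [u v] /= [].
move=> [h1 h2].
have : e / (2 * C + 1) * (2 * C + 1) = e by rewrite divfK// gt_eqF//; lra.
nra.
Unshelve. all: by end_near. Qed.

(** The point [w] may leave [K], as it does when a kernel centred in [K] is averaged over its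
    support. *)
Lemma compact_uniform_continuity (R : realType) (y : R * R -> R) (K : set (R * R)) e :
  compact K -> continuous y -> 0 < e ->
  exists2 d, 0 < d & forall z w, K z -> `|w.1 - z.1| <= d -> `|w.2 - z.2| <= d ->
    `|y w - y z| <= e.
Proof.
move=> /compact_near_coveringP cK cy e0.
pose P (d : R) (z : R * R) := 0 < d -> forall w, `|w.1 - z.1| <= d -> `|w.2 - z.2| <= d ->
    `|y w - y z| <= e.
have /cK : forall z, K z -> \forall z' \near z & d \near (0 : R), P d z'.
  move=> z Kz.
  have /cvgrPdist_lt/(_ (e / 2)) := cy z.
  rewrite divr_gt0// => /(_ isT) -[[/= A B] [/nbhs_ballP[a a0 aA] /nbhs_ballP[b b0 bB]] AB].
  pose m := Num.min a b / 2.
  have m0 : 0 < m by rewrite divr_gt0// lt_min a0.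
  have ma : m * 2 <= a by rewrite /m divfK// ge_min lexx.
  have mb : m * 2 <= b by rewrite /m divfK// ge_min lexx orbT.
  exists ((ball z.1 m `*` ball z.2 m : set (R * R)), ball (0 : R) m) => /=.
    split; last exact: nbhsx_ballx.
    by exists (ball z.1 m, ball z.2 m) => //=; split; exact: nbhsx_ballx.
  move=> [[z1 z2] d] /= [[h1 h2]]; rewrite /ball/= in h1 h2 *.
  rewrite sub0r normrN => hd d0 [w1 w2]/= k1 k2.
  rewrite gtr0_norm// in hd.
  have Hz : `|y z - y (z1, z2)| < e / 2.
    apply: AB; split => /=; [apply: aA|apply: bB]; rewrite /ball/=; lra.
  have Hw : `|y z - y (w1, w2)| < e / 2.
    apply: AB; split => /=; [apply: aA|apply: bB]; rewrite /ball/=.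
      by have := ler_distD z1 z.1 w1; rewrite (distrC z1); lra.
    by have := ler_distD z2 z.2 w2; rewrite (distrC z2); lra.
  have := ler_distD (y z) (y (w1, w2)) (y (z1, z2)).
  by rewrite (distrC (y (w1, w2)) (y z)); lra.
move=> /nbhs_ballP[d /= d0 hd].
exists (d / 2); first lra.
move=> z w Kz; apply: (hd (d / 2)) => //; last lra.
by rewrite /ball/= sub0r normrN gtr0_norm; lra.
Qed.

(** The integrals over [U] and over the compact [K] agree because the kernel vanishes off the box;
    on [K] local integrability makes them usable. *)
Lemma weak_derivative_tensor (R : realType) (U : set (R * R)) (v : R * R)
    (u g : R * R -> R) (a b c d : R) (K : set (R * R)) (f h : R -> R) (psi : R * R -> R) :
  weak_derivative U v u g -> bump_fun a b f -> bump_fun c d h -> box a b c d `<=` K ->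
  K `<=` U ->
  (forall z, is_derive z v (fun z => f z.1 * h z.2) (psi z)) ->
  (forall z, ~ box a b c d z -> psi z = 0) ->
  \int[lebesgue2 R]_(z in K) (u z * psi z)
  = - \int[lebesgue2 R]_(z in K) (g z * (f z.1 * h z.2)).
Proof.
move=> [_ _ W] bf bh BK KU dpsi psi0.
have mk (w q : R * R -> R) : (forall z, ~ box a b c d z -> q z = 0) ->
    \int[lebesgue2 R]_(z in K) (w z * q z) = \int[lebesgue2 R]_(z in U) (w z * q z).
  move=> q0; rewrite Rintegral_mkcond [RHS]Rintegral_mkcond; congr Rintegral.
  apply/funext => z; rewrite !patchE.
  have [Bz|/q0 ->] := pselect (box a b c d z).
    by rewrite !ifT// inE; [apply: KU|]; exact: BK.
  by rewrite mulr0 !if_same.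
rewrite (mk u)// (mk g (fun z => f z.1 * h z.2)); last exact: tensor_supp bf bh.
rewrite -W; last exact: tensor_test_function bf bh (subset_trans BK KU).
by apply: eq_Rintegral => z _; case: (dpsi z) => _ ->.
Qed.

Lemma Rintegral_ae_ge0 (R : realType) d (T : measurableType d)
    (mu : {measure set T -> \bar R}) (K : set T) (w : T -> R) :
  measurable K -> mu.-integrable K (EFin \o w) ->
  {ae mu, forall z, K z -> 0 <= w z} -> 0 <= \int[mu]_(z in K) w z.
Proof.
move=> mK iw [N [mN N0 hN]]; rewrite /Rintegral (negligible_integral mN)//.
apply: fine_ge0; apply: integral_ge0 => z [Kz Nz]; rewrite lee_fin.
apply: contrapT => w0; apply: Nz; apply: hN => /(_ Kz) h; exact: w0.
Qed.

Lemma Rintegral_ae_eq0 (R : realType) d (T : measurableType d)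
    (mu : {measure set T -> \bar R}) (K : set T) (w : T -> R) :
  measurable K -> mu.-integrable K (EFin \o w) ->
  {ae mu, forall z, K z -> w z = 0} -> \int[mu]_(z in K) w z = 0.
Proof.
move=> mK iw [N [mN N0 hN]]; rewrite /Rintegral (negligible_integral mN)//.
rewrite integral0_eq// => z [Kz Nz] /=; congr EFin.
apply: contrapT => w0; apply: Nz; apply: hN => /(_ Kz) h; exact: w0.
Qed.

Lemma Rintegral_comb4 (R : realType) d (T : measurableType d)
    (mu : {measure set T -> \bar R}) (K : set T) (f1 f2 f3 f4 : T -> R) (a2 a3 a4 : R) :
  measurable K -> mu.-integrable K (EFin \o f1) -> mu.-integrable K (EFin \o f2) ->
  mu.-integrable K (EFin \o f3) -> mu.-integrable K (EFin \o f4) ->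
  mu.-integrable K (EFin \o (fun z => f1 z - a2 * f2 z - a3 * f3 z + a4 * f4 z)) /\
  \int[mu]_(z in K) (f1 z - a2 * f2 z - a3 * f3 z + a4 * f4 z) =
  \int[mu]_(z in K) f1 z - a2 * \int[mu]_(z in K) f2 z - a3 * \int[mu]_(z in K) f3 z
    + a4 * \int[mu]_(z in K) f4 z.
Proof.
move=> mK i1 i2 i3 i4.
have iZ a f : mu.-integrable K (EFin \o f) -> mu.-integrable K (EFin \o (fun z => a * f z)).
  move=> fi; rewrite (_ : EFin \o _ = (fun z => a%:E * (f z)%:E)%E).
    exact: integrableZl.
  by apply/funext => z /=; rewrite EFinM.
have iD f g : mu.-integrable K (EFin \o f) -> mu.-integrable K (EFin \o g) ->
    mu.-integrable K (EFin \o (fun z => f z + g z)).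
  move=> fi gi; rewrite (_ : EFin \o _ = (fun z => (f z)%:E + (g z)%:E)%E).
    exact: integrableD.
  by apply/funext => z /=; rewrite EFinD.
have iB f g : mu.-integrable K (EFin \o f) -> mu.-integrable K (EFin \o g) ->
    mu.-integrable K (EFin \o (fun z => f z - g z)).
  move=> fi gi; rewrite (_ : EFin \o _ = (fun z => (f z)%:E - (g z)%:E)%E).
    exact: integrableB.
  by apply/funext => z /=; rewrite EFinB.
have j2 := iZ a2 _ i2; have j3 := iZ a3 _ i3; have j4 := iZ a4 _ i4.
have k1 := iB _ _ i1 j2; have k2 := iB _ _ k1 j3; have k3 := iD _ _ k2 j4.
split; first exact: k3.
by rewrite (RintegralD mK k2 j4) (RintegralB mK k1 j3) (RintegralB mK i1 j2) !RintegralZl.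
Qed.

Lemma lebesgue2_box_fin (R : realType) (a b c d : R) : (lebesgue2 R (box a b c d) < +oo)%E.
Proof.
have -> : lebesgue2 R (box a b c d) =
    (@lebesgue_measure R `[a, b]%classic * @lebesgue_measure R `[c, d]%classic)%E.
  by rewrite box_setX; apply: product_measure1E; exact: measurable_itv.
rewrite !lebesgue_measure_itv/=; case: ifP => _; case: ifP => _.
all: by rewrite ?mul0e ?mule0// -!EFinB -EFinM ltry.
Qed.

(** The derivatives are carried as explicit functions, so that [heat] is a pointwise expression.
    Continuity is asked of [F], to have maxima; derivatives are only compared at single points. *)
Definition C12 (R : realType) (F Fx Fxx Ft : R -> R -> R) : Prop :=
  continuous (fun z : R * R => F z.1 z.2) /\
  [/\ forall x t, is_derive (x : R) 1 (F ^~ t) (Fx x t),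
      forall x t, is_derive (x : R) 1 (Fx ^~ t) (Fxx x t) &
      forall x t, is_derive (t : R) 1 (F x) (Ft x t)].

(** This is the derivative in tau minus the operator L, with s = sigma^2/2 and b = r - q - s. *)
Definition heat (R : realType) (s b r : R) (F Fx Fxx Ft : R -> R -> R) (x t : R) : R :=
  Ft x t - s * Fxx x t - b * Fx x t + r * F x t.

(* The box lies in the past of t0, so that the notion makes sense up to the
   final time. *)
Definition heat_approx (R : realType) (s b r : R) (P : R -> Prop) (u : R * R -> R)
    (x0 t0 : R) : Prop :=
  exists2 rho, 0 < rho & forall e, 0 < e -> exists G Gx Gxx Gt : R -> R -> R,
    C12 G Gx Gxx Gt /\
    forall x t, box (x0 - rho) (x0 + rho) (t0 - rho) t0 (x, t) ->
      `|G x t - u (x, t)| <= e /\ P (heat s b r G Gx Gxx Gt x t).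

Lemma bump_bump1 (R : realType) (a b : R) : bump_fun a b (bump1 a b).
Proof. exact: bump_flat. Qed.

Lemma heat_approx_weak (R : realType) (s b r : R) (P : R -> Prop) (U : set (R * R))
    (y yx yxx yt : R * R -> R) (x0 t0 rho : R) :
  P = (fun v => 0 <= v) \/ P = (fun v => v = 0) ->
  continuous y ->
  weak_derivative U (e_x R) y yx -> weak_derivative U (e_x R) yx yxx ->
  weak_derivative U (e_tau R) y yt ->
  0 < rho ->
  (forall z, x0 - 2 * rho <= z.1 <= x0 + 2 * rho -> t0 - 2 * rho <= z.2 < t0 -> U z) ->
  {ae lebesgue2 R, forall z, x0 - 2 * rho <= z.1 <= x0 + 2 * rho ->
     t0 - 2 * rho <= z.2 < t0 -> P (yt z - s * yxx z - b * yx z + r * y z)} ->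
  heat_approx s b r P y x0 t0.
Proof.
move=> hP cy Wx Wxx Wt rho0 hU hae.
exists rho => // e e0.
have [d d0 hd] := compact_uniform_continuity
  (@compact_box R (x0 - rho) (x0 + rho) (t0 - rho) t0) cy e0.
(* The kernel reaches back by [2 * ep]: at most [d], for uniform closeness, and at most [rho], to
   stay inside [K]. *)
pose ep := Num.min d rho / 2.
have ep0 : 0 < ep by rewrite divr_gt0// lt_min d0.
have epd : 2 * ep <= d by rewrite /ep mulrC divfK// ge_min lexx.
have epr : 2 * ep <= rho by rewrite /ep mulrC divfK// ge_min lexx orbT.
(* [K] ends at [t0 - ep], hence is a compact subset of [U] and still contains all kernel supports
   used at times up to [t0]. *)
pose K := box (x0 - 2 * rho) (x0 + 2 * rho) (t0 - 2 * rho) (t0 - ep).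
have mK : measurable (K : set (measurableTypeR R * measurableTypeR R)).
  exact: measurable_box.
have KU : K `<=` U.
  by move=> z /andP[h1 h2]; apply: hU => //; lra.
have cK : compact K by exact: compact_box.
have [iy iyx] : (lebesgue2 R).-integrable K (EFin \o y) /\
    (lebesgue2 R).-integrable K (EFin \o yx).
  by case: Wx => h1 h2 _; split; [exact: h1|exact: h2].
have iyxx : (lebesgue2 R).-integrable K (EFin \o yxx).
  by case: Wxx => _ h _; exact: h.
have iyt : (lebesgue2 R).-integrable K (EFin \o yt).
  by case: Wt => _ h _; exact: h.
pose al := bump1 (- ep) ep.
(* The kernel is evaluated at [z.2 - t]; a negative support means averaging over times earlier than
   [t] by at least [ep]. *)
pose be := bump1 (- (2 * ep)) (- ep).
have epep : - ep < ep by lra.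
have epep2 : - (2 * ep) < - ep by lra.
have bal : bump_fun (- ep) ep al := bump_bump1 _ _.
have bbe : bump_fun (- (2 * ep)) (- ep) be := bump_bump1 _ _.
have [al1 bal1 dal] := bump_derive bal.
have [al2 bal2 dal1] := bump_derive bal1.
have [be1 bbe1 dbe] := bump_derive bbe.
have [A A0 hA] := bump_bounded (ltW epep) bal.
have [A1 A10 hA1] := bump_bounded (ltW epep) bal1.
have [A2 A20 hA2] := bump_bounded (ltW epep) bal2.
have [B B0 hB] := bump_bounded (ltW epep2) bbe.
have [B1 B10 hB1] := bump_bounded (ltW epep2) bbe1.
pose M := A + A1 + A2 + B + B1.
pose J (u : R * R -> R) (f g : R -> R) (x t : R) :=
  \int[lebesgue2 R]_(z in K) (u z * (f (z.1 - x) * g (z.2 - t))).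
have mfg (f g : R -> R) x t : bump_fun (- ep) ep f -> bump_fun (- (2 * ep)) (- ep) g ->
    measurable_fun (K : set (measurableTypeR R * measurableTypeR R))
    (fun z : measurableTypeR R * measurableTypeR R => f (z.1 - x) * g (z.2 - t) : R).
  move=> bf bg; apply: measurable_funTS.
  exact: measurable_tensor (bump_shift x bf) (bump_shift t bg).
have bd (f g : R -> R) : (forall x, `|f x| <= M) -> (forall x, `|g x| <= M) ->
   forall x t (z : R * R), `|f (z.1 - x) * g (z.2 - t)| <= M * M.
  by move=> hf hg x t z; rewrite normrM ler_pM.
have bA x : `|al x| <= M by have := hA x; rewrite /M; clear -A0 A10 A20 B0 B10; lra.
have bA1 x : `|al1 x| <= M by have := hA1 x; rewrite /M; clear -A0 A10 A20 B0 B10; lra.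
have bA2 x : `|al2 x| <= M by have := hA2 x; rewrite /M; clear -A0 A10 A20 B0 B10; lra.
have bB x : `|be x| <= M by have := hB x; rewrite /M; clear -A0 A10 A20 B0 B10; lra.
have bB1 x : `|be1 x| <= M by have := hB1 x; rewrite /M; clear -A0 A10 A20 B0 B10; lra.
have intJ u f g (x t : R) : (lebesgue2 R).-integrable K (EFin \o u) ->
    bump_fun (- ep) ep f -> bump_fun (- (2 * ep)) (- ep) g ->
    (forall x, `|f x| <= M) -> (forall x, `|g x| <= M) ->
    (lebesgue2 R).-integrable K (EFin \o (fun z => u z * (f (z.1 - x) * g (z.2 - t)))).
  move=> iu bf bg hf hg.
  exact: (integrable_mul_bounded mK iu (mfg f g x t bf bg) (bd f g hf hg x t)).
have dsh (f f' : R -> R) (c x : R) : (forall y : R, is_derive y 1 f (f' y)) ->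
    is_derive x 1 (fun x => f (c - x)) (- f' (c - x)).
  move=> df.
  have d1 : is_derive x 1 (fun x : R => c - x) (0 - 1).
    exact: (is_deriveB (is_derive_cst c (x : R) (1 : R)) (is_derive_id (x : R) (1 : R))).
  have := @is_derive1_comp R f (fun x => c - x) x _ _ (df (c - x)) d1.
  by rewrite sub0r mulrN1.
have dJx f f' g (x t : R) : bump_fun (- ep) ep f -> bump_fun (- ep) ep f' ->
    bump_fun (- (2 * ep)) (- ep) g -> (forall x, `|f x| <= M) -> (forall x, `|f' x| <= M) ->
    (forall x, `|g x| <= M) -> (forall y : R, is_derive y 1 f (f' y)) ->
    is_derive x 1 (J y f g ^~ t) (- J y f' g x t).
  move=> bf bf' bg hf hf' hg df.
  have -> : - J y f' g x t =
     \int[lebesgue2 R]_(z in K) (y z * (- f' (z.1 - x) * g (z.2 - t))).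
    rewrite -mulN1r /J -RintegralZl//; last exact: intJ.
    by apply: eq_Rintegral => z _; rewrite mulN1r mulNr mulrN.
  refine (@is_derive_param_integral R _ _ (lebesgue2 R) K y (fun (x : R) (z : R * R) => f (z.1 - x) * g (z.2 - t))
     (fun (x : R) (z : R * R) => - f' (z.1 - x) * g (z.2 - t)) (M * M) x mK iy _ _ _ _).
  - by move=> x1; exact: mfg.
  - by move=> x1 z; exact: (bd f g).
  - by move=> x1 z; rewrite mulNr normrN; exact: (bd f' g).
  move=> x1 z.
  have := @is_deriveM R R (fun x => f (z.1 - x)) (cst (g (z.2 - t))) x1 1 _ _ (dsh _ _ _ _ df)
    (is_derive_cst _ _ _).
  move=> h; apply: is_derive_eq h _.
  by rewrite /GRing.scale/= mulr0 add0r mulrC.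
have dJt f g g' (x t : R) : bump_fun (- ep) ep f -> bump_fun (- (2 * ep)) (- ep) g ->
    bump_fun (- (2 * ep)) (- ep) g' -> (forall x, `|f x| <= M) -> (forall x, `|g' x| <= M) ->
    (forall x, `|g x| <= M) -> (forall y : R, is_derive y 1 g (g' y)) ->
    is_derive t 1 (J y f g x) (- J y f g' x t).
  move=> bf bg bg' hf hg' hg dg.
  have -> : - J y f g' x t =
     \int[lebesgue2 R]_(z in K) (y z * (f (z.1 - x) * - g' (z.2 - t))).
    rewrite -mulN1r /J -RintegralZl//; last exact: intJ.
    by apply: eq_Rintegral => z _; rewrite mulN1r !mulrN.
  refine (@is_derive_param_integral R _ _ (lebesgue2 R) K y (fun (t : R) (z : R * R) => f (z.1 - x) * g (z.2 - t))
     (fun (t : R) (z : R * R) => f (z.1 - x) * - g' (z.2 - t)) (M * M) t mK iy _ _ _ _).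
  - by move=> x1; exact: mfg.
  - by move=> x1 z; exact: (bd f g).
  - by move=> x1 z; rewrite mulrN normrN; exact: (bd f g').
have iconst : (lebesgue2 R).-integrable K (EFin \o (fun=> 1 : R)).
  apply: measurable_bounded_integrable => //; first exact: lebesgue2_box_fin.
  exact: bounded_cst.
pose N := fine ((\int[lebesgue_measure]_y (al y)%:E) * (\int[lebesgue_measure]_y (be y)%:E))%E.
have JN (x t : R) : box (x0 - rho) (x0 + rho) (t0 - rho) t0 (x, t) -> J (fun=> 1) al be x t = N.
  move=> /andP[/= h1 h2].
  rewrite /J; under eq_Rintegral do rewrite mul1r.
  rewrite /Rintegral (@tensor_integral R _ _ _ _ x t K epep epep2 mK)// => z /andP[k1 k2].
  by apply/andP; clear -k1 k2 h1 h2 ep0 epr; split; lra.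
have N0 : 0 < N.
  rewrite /N fine_gt0//; apply/andP; split.
    by rewrite mule_gt0// bump1_int_gt0.
  have h0 : box (x0 - rho) (x0 + rho) (t0 - rho) t0 (x0, t0) by rewrite /box/= lexx !gerBl lerDl !(ltW rho0).
  (* [fine] sends infinity to 0, so positivity of [N] also needs finiteness; the product is finite
     as the integral of an integrable kernel over [K]. *)
  rewrite -(@tensor_integral R _ _ _ _ x0 t0 K epep epep2 mK)//; last first.
    by move=> z /andP[k1 k2]; apply/andP; clear -k1 k2 ep0 epr; split; lra.
  have /integrable_fin_num := intJ _ _ _ x0 t0 iconst bal bbe bA bB.
  under eq_integral do rewrite /= mul1r.
  by move=> /(_ mK); rewrite fin_numE => /andP[_]; rewrite ltey.
pose I0 := \int[lebesgue2 R]_(z in K) `|y z|.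
have Jbd f g (x t : R) : bump_fun (- ep) ep f -> bump_fun (- (2 * ep)) (- ep) g ->
    (forall x, `|f x| <= M) -> (forall x, `|g x| <= M) -> `|J y f g x t| <= I0 * (M * M).
  move=> bf bg hf hg; rewrite /J.
  have ii := intJ _ _ _ x t iy bf bg hf hg.
  apply: (le_trans (le_normr_Rintegral mK ii)).
  have iay : (lebesgue2 R).-integrable K (EFin \o (fun z => `|y z|)).
    by have := integrable_abse iy; apply: eq_integrable.
  rewrite /I0 -RintegralZr//; apply: le_Rintegral => //.
  - by have := integrable_abse ii; apply: eq_integrable.
  - apply: (integrable_mul_bounded (h := fun=> M * M) (C := `|M * M|)) => //.
  by move=> z _; rewrite normrM ler_wpM2l// bd.
pose G (x t : R) := N^-1 * J y al be x t.
pose Gx (x t : R) := N^-1 * - J y al1 be x t.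
pose Gxx (x t : R) := N^-1 * J y al2 be x t.
pose Gt (x t : R) := N^-1 * - J y al be1 x t.
have dGx (x t : R) : is_derive x 1 (G ^~ t) (Gx x t).
  exact: (@is_deriveZ R R R (J y al be ^~ t) N^-1 x 1 _ (dJx _ _ _ _ _ bal bal1 bbe bA bA1 bB dal)).
have dGxx (x t : R) : is_derive x 1 (Gx ^~ t) (Gxx x t).
  rewrite /Gxx -[J y al2 be x t]opprK.
  have dN := @is_deriveN R R R (J y al1 be ^~ t) x 1 _ (dJx _ _ _ x t bal1 bal2 bbe bA1 bA2 bB dal1).
  exact: (@is_deriveZ R R R (fun x => - J y al1 be x t) N^-1 x 1 _ dN).
have dGt (x t : R) : is_derive t 1 (G x) (Gt x t).
  exact: (@is_deriveZ R R R (J y al be x) N^-1 t 1 _ (dJt _ _ _ _ _ bal bbe bbe1 bA bB1 bB dbe)).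
exists G, Gx, Gxx, Gt; split.
  split; last by split.
  apply: (@continuous_of_bounded_partials R G Gx Gt (N^-1 * (I0 * (M * M)))) => //.
  - by move=> x t; rewrite /Gx normrM normrN gtr0_norm ?invr_gt0//; apply: ler_wpM2l; [by rewrite invr_ge0 ltW|exact: Jbd].
  - by move=> x t; rewrite /Gt normrM normrN gtr0_norm ?invr_gt0//; apply: ler_wpM2l; [by rewrite invr_ge0 ltW|exact: Jbd].
move=> x t hxt; split.
  have supp z : K z -> ~ box (x - ep) (x + ep) (t - 2 * ep) (t - ep) z ->
      al (z.1 - x) * be (z.2 - t) = 0.
    move=> _ hz; apply: (tensor_supp (bump_shift x bal) (bump_shift t bbe)).
    by move=> /andP[k1 k2]; apply: hz; apply/andP; clear -k1 k2; split; lra.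
  have yz z : K z -> al (z.1 - x) * be (z.2 - t) != 0 -> `|y z - y (x, t)| <= e.
    move=> Kz hz; apply: hd => //=.
      have : box (x - ep) (x + ep) (t - 2 * ep) (t - ep) z.
        by apply: contrapT => /(supp z Kz) h; rewrite h eqxx in hz.
      by move=> /andP[k1 k2]; rewrite ler_norml; clear -k1 k2 epd; lra.
    have : box (x - ep) (x + ep) (t - 2 * ep) (t - ep) z.
      by apply: contrapT => /(supp z Kz) h; rewrite h eqxx in hz.
    by move=> /andP[k1 k2]; rewrite ler_norml; clear -k1 k2 epd; lra.
  have eta0 (z : R * R) : 0 <= al (z.1 - x) * be (z.2 - t) by rewrite mulr_ge0 ?bump1_ge0.
  have i1 := intJ _ _ _ x t iconst bal bbe bA bB.
  have iy1 := intJ _ _ _ x t iy bal bbe bA bB.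
  have iZ (c : R) : (lebesgue2 R).-integrable K
      (EFin \o (fun z : R * R => c * (1 * (al (z.1 - x) * be (z.2 - t))))).
    rewrite (_ : EFin \o _ = (fun z => c%:E * (1 * (al (z.1 - x) * be (z.2 - t)))%:E)%E).
      exact: integrableZl.
    by apply/funext => z /=; rewrite EFinM.
  have lo : (y (x, t) - e) * N <= J y al be x t.
    rewrite -(JN x t hxt) /J -RintegralZl//; apply: le_Rintegral => //.
    move=> z Kz; have [->|hz] := eqVneq (al (z.1 - x) * be (z.2 - t)) 0.
      by rewrite !mulr0.
    rewrite mul1r; apply: ler_wpM2r => //.
    by have := yz z Kz hz; rewrite ler_norml; clear; lra.
  have hi : J y al be x t <= (y (x, t) + e) * N.
    rewrite -(JN x t hxt) /J -RintegralZl//; apply: le_Rintegral => //.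
    move=> z Kz; have [->|hz] := eqVneq (al (z.1 - x) * be (z.2 - t)) 0.
      by rewrite !mulr0.
    rewrite mul1r; apply: ler_wpM2r => //.
    by have := yz z Kz hz; rewrite ler_norml; clear; lra.
  rewrite /G ler_distl; apply/andP; split.
    by rewrite mulrC ler_pdivlMr.
  by rewrite mulrC ler_pdivrMr.
have BK : box (- ep + x) (ep + x) (- (2 * ep) + t) (- ep + t) `<=` K.
  by move: hxt => /andP[/= h1 h2] z /andP[k1 k2]; apply/andP; clear -k1 k2 h1 h2 ep0 epr; split; lra.
have dshift (f f' : R -> R) (c x1 : R) : (forall y : R, is_derive y 1 f (f' y)) ->
    is_derive x1 1 (fun x => f (x - c)) (f' (x1 - c)).
  move=> df.
  have d1 : is_derive x1 1 (fun x : R => x - c) (1 - 0).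
    exact: (is_deriveB (is_derive_id (x1 : R) (1 : R)) (is_derive_cst c (x1 : R) (1 : R))).
  have := @is_derive1_comp R f (fun x => x - c) x1 _ _ (df (x1 - c)) d1.
  by rewrite subr0 mulr1.
have wx u g f f' : weak_derivative U (e_x R) u g -> bump_fun (- ep) ep f -> bump_fun (- ep) ep f' ->
    (forall y : R, is_derive y 1 f (f' y)) -> J u f' be x t = - J g f be x t.
  move=> W bf bf' df.
  apply: (weak_derivative_tensor (f := fun z => f (z - x)) (h := fun z => be (z - t))
    W (bump_shift x bf) (bump_shift t bbe) BK KU).
    by move=> z; apply: (@is_derive_tensor_x R (fun z => f (z - x)) (fun z => be (z - t))); exact: dshift.
  exact: (tensor_supp (bump_shift x bf') (bump_shift t bbe)).
have wt : J y al be1 x t = - J yt al be x t.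
  apply: (weak_derivative_tensor (f := fun z => al (z - x)) (h := fun z => be (z - t))
    Wt (bump_shift x bal) (bump_shift t bbe) BK KU).
    by move=> z; apply: (@is_derive_tensor_tau R (fun z => al (z - x)) (fun z => be (z - t))); exact: dshift.
  exact: (tensor_supp (bump_shift x bal) (bump_shift t bbe1)).
have e1 : J y al1 be x t = - J yx al be x t by exact: wx.
have e2 : J y al2 be x t = J yxx al be x t.
  by rewrite (wx y yx al1 al2)// (wx yx yxx al al1)// opprK.
have [iw Ew] := @Rintegral_comb4 R _ _ (lebesgue2 R) K _ _ _ _ s b r mK
  (intJ _ _ _ x t iyt bal bbe bA bB) (intJ _ _ _ x t iyxx bal bbe bA bB)
  (intJ _ _ _ x t iyx bal bbe bA bB) (intJ _ _ _ x t iy bal bbe bA bB).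
(* The sign from differentiating the kernel in its centre cancels the one from the weak derivative,
   so [heat] of the average is the average of the weak expression. *)
have -> : heat s b r G Gx Gxx Gt x t =
   N^-1 * (J yt al be x t - s * J yxx al be x t - b * J yx al be x t + r * J y al be x t).
  by rewrite /heat /Gt /Gxx /Gx /G wt e1 e2; ring.
rewrite /J -Ew.
have wE (z : R * R) : yt z * (al (z.1 - x) * be (z.2 - t)) - s * (yxx z * (al (z.1 - x) * be (z.2 - t)))
     - b * (yx z * (al (z.1 - x) * be (z.2 - t))) + r * (y z * (al (z.1 - x) * be (z.2 - t)))
   = (yt z - s * yxx z - b * yx z + r * y z) * (al (z.1 - x) * be (z.2 - t)) by ring.
case: hP hae => -> hae.
  apply: mulr_ge0; first by rewrite invr_ge0 ltW.
  apply: Rintegral_ae_ge0 => //.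
  have [Z [mZ Z0 hZ]] := hae; exists Z; split => //; apply: subset_trans hZ => z.
  apply: contra_not => hz Kz; rewrite wE mulr_ge0//; last by rewrite mulr_ge0 ?bump1_ge0.
  by move: Kz => /andP[k1 k2]; apply: hz => //; clear -k1 k2 ep0; lra.
rewrite Rintegral_ae_eq0 ?mulr0//.
have [Z [mZ Z0 hZ]] := hae; exists Z; split => //; apply: subset_trans hZ => z.
apply: contra_not => hz Kz; rewrite wE hz ?mul0r//.
  by move: Kz => /andP[k1 k2].
by move: Kz => /andP[k1 k2]; clear -k1 k2 ep0; lra.
Qed.

(** * Maximum principle *)

Lemma derive_quotient (R : realType) (f : R -> R) (x d e : R) :
  is_derive x 1 f d -> 0 < e ->
  exists2 dl, 0 < dl & forall h, h != 0 -> `|h| < dl -> `|d - h^-1 * (f (h + x) - f x)| < e.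
Proof.
move=> [/cvg_ex[l hl] dE] e0.
have {}dE : l = d by rewrite -dE; exact/esym/cvg_lim.
move: hl; rewrite dE => /cvgrPdist_lt/(_ e e0) [dl /= dl0 H].
exists dl => // h h0 hdl.
have := H h; rewrite /= sub0r normrN => /(_ hdl h0).
by rewrite /GRing.scale/= mulr1.
Qed.

(** If [g2 x0] were positive, [g1] would be positive just to the right of [x0], and the mean value
    theorem would give a larger value there. *)
Lemma interior_max_derive2 (R : realType) (g g1 g2 : R -> R) (x0 rho : R) :
  0 < rho -> (forall x : R, is_derive x 1 g (g1 x)) ->
  (forall x : R, is_derive x 1 g1 (g2 x)) ->
  (forall x, x0 - rho <= x <= x0 + rho -> g x <= g x0) ->
  g1 x0 = 0 /\ g2 x0 <= 0.
Proof.
move=> rho0 dg dg1 gmax.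
have h0 : is_derive x0 1 g 0.
  apply: (@derive1_at_max _ g (x0 - rho) (x0 + rho)).
  - lra.
  - by move=> t _; case: (dg t).
  - by rewrite in_itv/=; lra.
  by move=> t; rewrite in_itv/= => ht; apply: gmax; lra.
have g10 : g1 x0 = 0.
  by case: h0 => _ <-; case: (dg x0) => _ <-.
split=> //; rewrite leNgt; apply/negP => g20.
have [dl dl0 H] := derive_quotient (dg1 x0) g20.
pose h := Num.min dl rho / 2.
have h_gt0 : 0 < h by rewrite divr_gt0// lt_min dl0.
have hdl : 2 * h <= dl by rewrite /h mulrC divfK// ge_min lexx.
have hrho : 2 * h <= rho by rewrite /h mulrC divfK// ge_min lexx orbT.
have xh : x0 < x0 + h by lra.
have cf : {within `[x0, x0 + h], continuous g}.
  apply: continuous_subspaceT => z.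
  by apply/differentiable_continuous/derivable1_diffP; case: (dg z).
have [c + E] := MVT xh (fun z _ => dg z) cf; rewrite in_itv/= => hc.
have c0 : 0 < c - x0 by lra.
have := H (c - x0); rewrite gt_eqF// => /(_ isT).
rewrite gtr0_norm// subrK g10 subr0 => /(_ ltac:(lra)).
rewrite ltr_distlC subrr => /andP[+ _].
rewrite pmulr_rgt0 ?invr_gt0// => g1c.
have := gmax (x0 + h); have : 0 < g1 c * (x0 + h - x0) by rewrite mulr_gt0//; lra.
by rewrite -E => ? /(_ ltac:(lra)); lra.
Qed.

(** Only past values are compared, so the maximum yields a sign and not a vanishing derivative. *)
Lemma left_max_derive (R : realType) (g : R -> R) (t0 rho d : R) :
  0 < rho -> is_derive t0 1 g d ->
  (forall t, t0 - rho <= t <= t0 -> g t <= g t0) -> 0 <= d.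
Proof.
move=> rho0 dg gmax; rewrite leNgt; apply/negP => d0.
have [|dl dl0 H] := derive_quotient dg (e := - d); first by rewrite oppr_gt0.
pose h := Num.min dl rho / 2.
have h_gt0 : 0 < h by rewrite divr_gt0// lt_min dl0.
have hdl : 2 * h <= dl by rewrite /h mulrC divfK// ge_min lexx.
have hrho : 2 * h <= rho by rewrite /h mulrC divfK// ge_min lexx orbT.
have := H (- h); rewrite oppr_eq0 gt_eqF// => /(_ isT).
rewrite normrN gtr0_norm// => /(_ ltac:(lra)).
rewrite ltr_distlC opprK subrr => /andP[_].
rewrite invrN mulNr oppr_lt0 pmulr_rgt0 ?invr_gt0// subr_gt0 ltNge => /negP; apply.
by apply: gmax; lra.
Qed.

(** * Linear operations on classical functions and on approximable ones *)

Lemma C12D (R : realType) (F Fx Fxx Ft G Gx Gxx Gt : R -> R -> R) :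
  C12 F Fx Fxx Ft -> C12 G Gx Gxx Gt ->
  C12 (fun x t => F x t + G x t) (fun x t => Fx x t + Gx x t)
    (fun x t => Fxx x t + Gxx x t) (fun x t => Ft x t + Gt x t).
Proof.
move=> [cF [F1 F2 F3]] [cG [G1 G2 G3]]; split; last split.
- by move=> z; exact: (@continuousD _ _ _ (fun z => F z.1 z.2) (fun z => G z.1 z.2) z (cF z) (cG z)).
- by move=> x t; apply: (@is_deriveD R R R (F ^~ t) (G ^~ t)).
- by move=> x t; apply: (@is_deriveD R R R (Fx ^~ t) (Gx ^~ t)).
- by move=> x t; apply: (@is_deriveD R R R (F x) (G x)).
Qed.

Lemma C12Z (R : realType) (a : R) (F Fx Fxx Ft : R -> R -> R) :
  C12 F Fx Fxx Ft ->
  C12 (fun x t => a * F x t) (fun x t => a * Fx x t)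
    (fun x t => a * Fxx x t) (fun x t => a * Ft x t).
Proof.
move=> [cF [F1 F2 F3]]; split; last split.
- move=> z; apply: (@continuousM _ _ (fun=> a) (fun z => F z.1 z.2) z); last exact: cF.
  exact: cvg_cst.
- by move=> x t; apply: (@is_deriveZ R R R (F ^~ t)).
- by move=> x t; apply: (@is_deriveZ R R R (Fx ^~ t)).
- by move=> x t; apply: (@is_deriveZ R R R (F x)).
Qed.

Lemma C12_tensor (R : realType) (f f1 f2 g g1 : R -> R) :
  (forall x : R, is_derive x 1 f (f1 x)) -> (forall x : R, is_derive x 1 f1 (f2 x)) ->
  (forall t : R, is_derive t 1 g (g1 t)) ->
  C12 (fun x t => f x * g t) (fun x t => f1 x * g t) (fun x t => f2 x * g t)
    (fun x t => f x * g1 t).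
Proof.
move=> df df1 dg; split; last split.
- apply: continuous_tensor => z; apply/differentiable_continuous/derivable1_diffP.
    by case: (df z).
  by case: (dg z).
- move=> x t; have := @is_deriveM R R f (cst (g t)) x 1 _ _ (df x) (is_derive_cst _ _ _).
  by move=> h; apply: is_derive_eq h _; rewrite /GRing.scale/= mulr0 add0r mulrC.
- move=> x t; have := @is_deriveM R R f1 (cst (g t)) x 1 _ _ (df1 x) (is_derive_cst _ _ _).
  by move=> h; apply: is_derive_eq h _; rewrite /GRing.scale/= mulr0 add0r mulrC.
- by move=> x t; apply: (@is_deriveZ R R R g).
Qed.

Lemma C12_cst (R : realType) (c : R) :
  C12 (fun _ _ : R => c) (fun _ _ => 0) (fun _ _ => 0) (fun _ _ => 0).
Proof. by split; [move=> z; exact: cvg_cst|split=> x t; exact: is_derive_cst]. Qed.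

Lemma C12_poly_time (R : realType) (q : {poly R}) (g g1 : R -> R) :
  (forall t : R, is_derive t 1 g (g1 t)) ->
  C12 (fun x t => q.[x] * g t) (fun x t => (deriv q).[x] * g t) (fun x t => (deriv (deriv q)).[x] * g t)
    (fun x t => q.[x] * g1 t).
Proof.
move=> dg; apply: (@C12_tensor R (horner q) (horner (deriv q)) (horner (deriv (deriv q)))) => //.
all: by move=> x; exact: is_derive_poly.
Qed.

Lemma C12_quadratic (R : realType) (x0 t0 c p B k : R) :
  C12 (fun x t => c + p * (x - x0) + B * (x - x0) ^+ 2 + k * (t - t0))
    (fun x t : R => p + 2 * B * (x - x0)) (fun x t : R => 2 * B) (fun x t : R => k).
Proof.
have dk (t : R) : is_derive t 1 (fun t : R => k * (t - t0)) k.
  have h := is_deriveB (is_derive_id (t : R) (1 : R)) (is_derive_cst t0 (t : R) (1 : R)).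
  apply: is_derive_eq (is_deriveZ k h) _.
  by rewrite /GRing.scale/= subr0 mulr1.
pose q : {poly R} := c%:P + p *: ('X - x0%:P) + B *: ('X - x0%:P) ^+ 2.
have C1 := C12_poly_time q (fun t : R => is_derive_cst (1 : R) t (1 : R)).
have C2 := C12_poly_time 1 dk.
have := C12D C1 C2.
congr C12; apply/funext => x; apply/funext => t; rewrite /q /= ?(poly.derivE, hornerE) /=; ring.
Qed.

Lemma C12_penalty (R : realType) (x0 t0 : R) :
  C12 (fun x t => (x - x0) ^+ 2 + (t0 - t)) (fun x t : R => 2 * (x - x0))
    (fun x t : R => 2) (fun x t : R => -1).
Proof.
have := C12_quadratic x0 t0 0 0 1 (-1).
by congr C12; apply/funext => x; apply/funext => t; ring.
Qed.

Lemma heat_approx_weaken (R : realType) (s b r : R) (P Q : R -> Prop) u (x0 t0 : R) :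
  (forall v, P v -> Q v) -> heat_approx s b r P u x0 t0 -> heat_approx s b r Q u x0 t0.
Proof.
move=> PQ [rho rho0 H]; exists rho => // e /H[G [Gx [Gxx [Gt [c h]]]]].
by exists G, Gx, Gxx, Gt; split=> // x t /h[? /PQ].
Qed.

(** Approximants of the translate and of [v], each at precision [e / 2], are subtracted; the
    constant coefficients make the translated approximant satisfy the same relation. *)
Lemma heat_approx_shift_sub (R : realType) (s b r : R) (P1 P2 P : R -> Prop)
    (u v : R * R -> R) (h k x0 t0 : R) :
  (forall a b, P1 a -> P2 b -> P (a - b)) ->
  heat_approx s b r P1 u (x0 + h) (t0 + k) -> heat_approx s b r P2 v x0 t0 ->
  heat_approx s b r P (fun z => u (z.1 + h, z.2 + k) - v z) x0 t0.
Proof.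
move=> PP [r1 r10 H1] [r2 r20 H2].
exists (Num.min r1 r2); first by rewrite lt_min r10.
move=> e e0; have e20 : 0 < e / 2 by lra.
have [F [Fx [Fxx [Ft [[cF [F1 F2 F3]] hF]]]]] := H1 _ e20.
have [G [Gx [Gxx [Gt [CG hG]]]]] := H2 _ e20.
have dsh (f f' : R -> R) (c : R) (x : R) : (forall y : R, is_derive y 1 f (f' y)) ->
    is_derive x 1 (fun x => f (x + c)) (f' (x + c)).
  move=> df.
  have d1 : is_derive x 1 (fun x : R => x + c) (1 + 0).
    exact: (is_deriveD (is_derive_id (x : R) (1 : R)) (is_derive_cst c (x : R) (1 : R))).
  have := @is_derive1_comp R f (fun x => x + c) x _ _ (df (x + c)) d1.
  by rewrite addr0 mulr1.
have CF : C12 (fun x t => F (x + h) (t + k)) (fun x t => Fx (x + h) (t + k))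
     (fun x t => Fxx (x + h) (t + k)) (fun x t => Ft (x + h) (t + k)).
  split; last split.
  - move=> z; apply: (@continuous_comp _ _ _ (fun z : R * R => (z.1 + h, z.2 + k))
      (fun z => F z.1 z.2) z); last exact: cF.
    have c1 : (fun z : R * R => z.1 + h) @ z --> z.1 + h.
      by apply: cvgD; [exact: cvg_fst|exact: cvg_cst].
    have c2 : (fun z : R * R => z.2 + k) @ z --> z.2 + k.
      by apply: cvgD; [exact: cvg_snd|exact: cvg_cst].
    exact: (cvg_pair c1 c2).
  - by move=> x t; apply: (dsh (F ^~ (t + k)) (Fx ^~ (t + k))).
  - by move=> x t; apply: (dsh (Fx ^~ (t + k)) (Fxx ^~ (t + k))).
  - by move=> x t; apply: (dsh (F (x + h)) (Ft (x + h))).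
do 4!eexists; split; first exact: (C12D CF (C12Z (-1) CG)).
move=> x t /andP[/= hx ht].
have r1E : Num.min r1 r2 <= r1 by rewrite ge_min lexx.
have r2E : Num.min r1 r2 <= r2 by rewrite ge_min lexx orbT.
have [|f1 f2] := hF (x + h) (t + k); first by apply/andP; split => /=; lra.
have [|g1 g2] := hG x t; first by apply/andP; split => /=; lra.
split; first by move: f1 g1; rewrite !ler_norml; lra.
have := PP _ _ f2 g2; congr P; rewrite /heat; ring.
Qed.

Lemma heat_approx_opp (R : realType) (s b r : R) (P Q : R -> Prop) u (x0 t0 : R) :
  (forall v, P v -> Q (- v)) -> heat_approx s b r P u x0 t0 ->
  heat_approx s b r Q (fun z => - u z) x0 t0.
Proof.
move=> PQ [rho rho0 H]; exists rho => // e /H[G [Gx [Gxx [Gt [c h]]]]].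
do 4!eexists; split; first exact: (C12Z (-1) c).
move=> x t /h[h1 /PQ h2]; split; first by rewrite mulN1r -opprD normrN.
by move: h2; congr Q; rewrite /heat; ring.
Qed.

Lemma C12B_continuous (R : realType) (F Fx Fxx Ft G Gx Gxx Gt : R -> R -> R) :
  C12 F Fx Fxx Ft -> C12 G Gx Gxx Gt -> continuous (fun z : R * R => F z.1 z.2 - G z.1 z.2).
Proof.
move=> [cF _] [cG _] z.
exact: (@continuousB _ _ _ (fun z => F z.1 z.2) (fun z => G z.1 z.2) z (cF z) (cG z)).
Qed.

Lemma box_max (R : realType) (a b c d : R) (f : R * R -> R) : a <= b -> c <= d ->
  continuous f -> exists x1 t1, box a b c d (x1, t1) /\
  forall x t, box a b c d (x, t) -> f (x, t) <= f (x1, t1).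
Proof.
move=> ab cd cf.
have n0 : box a b c d !=set0 by exists (a, c); rewrite /box/= !lexx ab cd.
have [[x1 t1] h1 h2] := compact_EVT_max n0 (@compact_box R a b c d) (continuous_subspaceT cf).
exists x1, t1; split; first by rewrite inE in h1.
by move=> x t h; apply: h2; rewrite inE.
Qed.

(* The strict penalty [ka * ((x - x0) ^+ 2 + (t0 - t))] moves the maximum of
   [G - phi'] away from the lateral and bottom sides of the box. *)
Lemma no_touching_from_above (R : realType) (s b r : R) (u : R * R -> R) (x0 t0 : R)
    (phi phix phixx phit : R -> R -> R) (dl rho : R) :
  0 <= s -> 0 <= r ->
  heat_approx s b r (fun v => v <= 0) u x0 t0 -> C12 phi phix phixx phit ->
  0 < dl -> 0 < rho -> u (x0, t0) = phi x0 t0 ->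
  (forall x t, box (x0 - rho) (x0 + rho) (t0 - rho) t0 (x, t) -> u (x, t) <= phi x t) ->
  (forall x t, box (x0 - rho) (x0 + rho) (t0 - rho) t0 (x, t) ->
     dl <= heat s b r phi phix phixx phit x t) -> False.
Proof.
move=> s0 r0 [rho1 rho10 H] Cphi dl0 rho20 u0 ule hphi.
pose ro := Num.min 1 (Num.min rho1 rho).
have ro0 : 0 < ro by rewrite !lt_min ltr01 rho10 rho20.
have ro1 : ro <= 1 by rewrite ge_min lexx.
have roA : ro <= rho1 by rewrite !ge_min lexx !orbT.
have roB : ro <= rho by rewrite !ge_min lexx !orbT.
(* On a box of radius at most 1, [heat] of the penalty is at least [- L]; [ka] is chosen so that the
   penalty costs at most half of [dl]. *)
pose L := 1 + 2 * s + 2 * `|b|.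
have L0 : 0 < L by have := normr_ge0 b; rewrite /L; clear -s0; lra.
pose ka := dl / (2 * L).
have ka0 : 0 < ka by rewrite divr_gt0//; clear -L0; lra.
have kaL : ka * L = dl / 2 by rewrite /ka; field; rewrite gt_eqF.
(* The three bounds keep the maximum off the lateral sides, keep it off the bottom, and make [r * e]
   smaller than the remaining half of [dl]. *)
pose e := Num.min (ka * ro ^+ 2 / 4) (Num.min (ka * ro / 4) (dl / (4 * (r + 1)))).
have ro20 : 0 < ro ^+ 2 by rewrite exprn_gt0.
have e0 : 0 < e.
  have m1 : 0 < ka * ro ^+ 2 / 4 by rewrite divr_gt0// mulr_gt0.
  have m2 : 0 < ka * ro / 4 by rewrite divr_gt0// mulr_gt0.
  have m3 : 0 < dl / (4 * (r + 1)) by rewrite divr_gt0//; clear -r0; lra.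
  by rewrite !lt_min m1 m2.
have e1 : 4 * e <= ka * ro ^+ 2.
  by rewrite mulrC -ler_pdivlMr// /e ge_min lexx.
have e2 : 4 * e <= ka * ro.
  by rewrite mulrC -ler_pdivlMr// /e !ge_min lexx orbT.
have e3 : r * e < dl / 2.
  have r1 : 0 < 4 * (r + 1) by clear -r0; lra.
  have : e * (4 * (r + 1)) <= dl.
    by rewrite -ler_pdivlMr// /e !ge_min lexx !orbT.
  by clear -r0 e0 dl0; nra.
have [G [Gx [Gxx [Gt [CG hG]]]]] := H e e0.
pose Q (x t : R) := (x - x0) ^+ 2 + (t0 - t).
have Cpsi := C12D Cphi (C12Z ka (C12_penalty x0 t0)).
set psi := (fun x t : R => phi x t + _) in Cpsi.
set psix := (fun x t : R => phix x t + _) in Cpsi.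
set psixx := (fun x t : R => phixx x t + _) in Cpsi.
set psit := (fun x t : R => phit x t + _) in Cpsi.
have sub x t : box (x0 - ro) (x0 + ro) (t0 - ro) t0 (x, t) ->
    box (x0 - rho1) (x0 + rho1) (t0 - rho1) t0 (x, t) /\
    box (x0 - rho) (x0 + rho) (t0 - rho) t0 (x, t).
  by rewrite /box/= => h; clear -h roA roB; split; lra.
have [x1 [t1 [h1 hmax]]] : exists x1 t1, box (x0 - ro) (x0 + ro) (t0 - ro) t0 (x1, t1) /\
   forall x t, box (x0 - ro) (x0 + ro) (t0 - ro) t0 (x, t) ->
     G x t - psi x t <= G x1 t1 - psi x1 t1.
  apply: (@box_max R _ _ _ _ (fun z => G z.1 z.2 - psi z.1 z.2)); [clear -ro0; lra..|].
  exact: C12B_continuous CG Cpsi.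
have h0 : box (x0 - ro) (x0 + ro) (t0 - ro) t0 (x0, t0).
  by rewrite /box/= lexx !gerBl lerDl !(ltW ro0).
have G0 : - e <= G x1 t1 - psi x1 t1.
  apply: le_trans (hmax _ _ h0).
  have [_ _] := sub _ _ h0; have [] := hG _ _ (proj1 (sub _ _ h0)).
  have -> : psi x0 t0 = phi x0 t0 by rewrite /psi; ring.
  rewrite u0 ler_norml.
  by clear; lra.
have [hA hB] := sub _ _ h1.
have [Gu HG] := hG _ _ hA.
(* The maximum is at least [- e], its value scale at [(x0, t0)], and at most [e - ka * Q] since [u]
   lies below [phi]. *)
have Qle : ka * Q x1 t1 <= 2 * e.
  have := ule _ _ hB; move: Gu G0; rewrite /psi -/(Q x1 t1) ler_norml.
  by clear; lra.
have t1t0 : 0 <= t0 - t1 by move: h1; rewrite /box/=; clear; lra.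
have Qx : (x1 - x0) ^+ 2 < ro ^+ 2.
  rewrite -(ltr_pM2l ka0); have : 0 <= ka * (t0 - t1) by rewrite mulr_ge0// ltW.
  by move: Qle; rewrite /Q; clear -e1 e0; lra.
have Qt : t0 - t1 < ro.
  rewrite -(ltr_pM2l ka0); have : 0 <= ka * (x1 - x0) ^+ 2 by rewrite mulr_ge0 ?sqr_ge0// ltW.
  by move: Qle; rewrite /Q; clear -e2 e0; lra.
have Qx' : `|x1 - x0| < ro.
  by rewrite -(ltr_pXn2r (n := 2))// ?nnegrE ?(ltW ro0)// real_normK ?num_real.
have [cG [G1 G2 G3]] := CG.
have [cp [p1 p2 p3]] := Cpsi.
have [Ex Exx] : (Gx x1 t1 - psix x1 t1 = 0) /\ Gxx x1 t1 - psixx x1 t1 <= 0.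
  apply: (@interior_max_derive2 R (fun x => G x t1 - psi x t1) (fun x => Gx x t1 - psix x t1)
     (fun x => Gxx x t1 - psixx x t1) x1 (ro - `|x1 - x0|)).
  - by clear -Qx'; lra.
  move=> x hx; apply: hmax; move: h1; rewrite /box/=.
  have := ler_norm (x1 - x0); have := ler_norm (x0 - x1); rewrite (distrC x0).
  by clear -hx; lra.
have Et : 0 <= Gt x1 t1 - psit x1 t1.
  apply: (@left_max_derive R (fun t => G x1 t - psi x1 t) t1 (t1 - (t0 - ro))).
  - by clear -Qt; lra.
  move=> t ht; apply: hmax; move: h1; rewrite /box/=.
  by clear -ht; lra.
(* At the maximum, [heat] of [G] is at least that of [psi] minus [r * e], hence exceeds dl - dl/2 -
   dl/2 = 0, against [HG]. *)
have := hphi _ _ hB.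
have rG : r * (psi x1 t1 - e) <= r * G x1 t1.
  by apply: ler_wpM2l => //; clear -G0; lra.
have sG : s * Gxx x1 t1 <= s * psixx x1 t1.
  by apply: ler_wpM2l => //; clear -Exx; lra.
have bx : `|b * (x1 - x0)| <= `|b|.
  by rewrite normrM ler_piMr//; clear -Qx' ro1; lra.
have rQ : 0 <= r * Q x1 t1.
  by rewrite mulr_ge0// addr_ge0// sqr_ge0.
have kQ : 0 <= ka * (r * Q x1 t1) by rewrite mulr_ge0// ltW.
have bx' : ka * (b * (x1 - x0)) <= ka * `|b|.
  by apply: ler_wpM2l; [exact: ltW|exact: le_trans (ler_norm _) bx].
have Exx' : b * Gx x1 t1 = b * psix x1 t1 by congr (_ * _); clear -Ex; lra.
move: HG; rewrite /heat Exx'.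
move: Et rG sG kQ kaL.
rewrite /psi /psix /psixx /psit -/(Q x1 t1) /L.
clear -bx' e3.
move: (Gt x1 t1) (Gxx x1 t1) (G x1 t1) (phi x1 t1) (phix x1 t1) (phixx x1 t1) (phit x1 t1) (Q x1 t1) bx'.
by move=> gt gxx g p px pxx pt q; nra.
Qed.

(** At a positive maximum [m] of [u - phi], possibly at the final time, [phi + m] touches [u] from
    above, and adding [m] raises [heat] by [r * m >= 0]. The subsolution property is asked only
    where [u] exceeds [phi], which suits solutions that satisfy the equation only off the
    obstacle. *)
Lemma box_comparison_sub (R : realType) (s b r : R) (u : R * R -> R)
    (phi phix phixx phit : R -> R -> R) (x1 x2 t1 t2 dl : R) :
  0 <= s -> 0 <= r -> 0 < dl -> continuous u -> C12 phi phix phixx phit ->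
  (forall x t, x1 < x < x2 -> t1 < t <= t2 -> phi x t < u (x, t) ->
     heat_approx s b r (fun v => v <= 0) u x t) ->
  (forall x t, x1 <= x <= x2 -> t1 <= t <= t2 -> dl <= heat s b r phi phix phixx phit x t) ->
  (forall x, x1 <= x <= x2 -> u (x, t1) <= phi x t1) ->
  (forall t, t1 <= t <= t2 -> u (x1, t) <= phi x1 t) ->
  (forall t, t1 <= t <= t2 -> u (x2, t) <= phi x2 t) ->
  forall x t, x1 <= x <= x2 -> t1 <= t <= t2 -> u (x, t) <= phi x t.
Proof.
move=> s0 r0 dl0 cu Cphi sub hphi bot lft rgt x t hx ht.
have cup : continuous (fun z : R * R => u z - phi z.1 z.2).
  by move=> z; case: Cphi => cp _; exact: (@continuousB _ _ _ u (fun z => phi z.1 z.2) z (cu z) (cp z)).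
have [||xm [tm [hm hmax]]] := @box_max R x1 x2 t1 t2 _ _ _ cup.
- by clear -hx; lra.
- by clear -ht; lra.
move: hmax; rewrite /= => hmax.
have hxm : x1 <= xm <= x2 by case/andP: hm.
have htm : t1 <= tm <= t2 by case/andP: hm.
rewrite leNgt; apply/negP => xt.
pose m := u (xm, tm) - phi xm tm.
have m0 : 0 < m.
  have : box x1 x2 t1 t2 (x, t) by rewrite /box/= hx ht.
  by move=> /hmax; rewrite -/m; clear -xt; lra.
have nx1 : xm != x1.
  by apply: contraTneq m0 => E; rewrite /m E -leNgt; have := lft _ htm; clear; lra.
have nx2 : xm != x2.
  by apply: contraTneq m0 => E; rewrite /m E -leNgt; have := rgt _ htm; clear; lra.
have nt1 : tm != t1.
  by apply: contraTneq m0 => E; rewrite /m E -leNgt; have := bot _ hxm; clear; lra.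
have x1m : x1 < xm by rewrite lt_neqAle eq_sym nx1; case/andP: hxm.
have x2m : xm < x2 by rewrite lt_neqAle nx2; case/andP: hxm.
have t1m : t1 < tm by rewrite lt_neqAle eq_sym nt1; case/andP: htm.
pose ro := Num.min (tm - t1) (Num.min (xm - x1) (x2 - xm)).
have ro0 : 0 < ro by rewrite !lt_min !subr_gt0 t1m x1m x2m.
have roT : ro <= tm - t1 by rewrite ge_min lexx.
have ro1 : ro <= xm - x1 by rewrite !ge_min lexx orbT.
have ro2 : ro <= x2 - xm by rewrite !ge_min lexx !orbT.
have inb x' t' : box (xm - ro) (xm + ro) (tm - ro) tm (x', t') ->
    x1 <= x' <= x2 /\ t1 <= t' <= t2.
  by rewrite /box/= => h; clear -h roT ro1 ro2 htm; split; lra.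
apply: (no_touching_from_above s0 r0 (sub xm tm _ _ _) (C12D Cphi (C12_cst m)) dl0 ro0).
- by rewrite x1m.
- by rewrite t1m; case/andP: htm.
- by rewrite -subr_gt0.
- by rewrite /m addrCA subrr addr0.
- move=> x' t' /inb[h1 h2].
  have : box x1 x2 t1 t2 (x', t') by rewrite /box/= h1 h2.
  by move=> /hmax; rewrite -/m; clear; lra.
move=> x' t' /inb[h1 h2]; apply: (le_trans (hphi x' t' h1 h2)); rewrite /heat.
have : 0 <= r * m by rewrite mulr_ge0// ltW.
by clear; lra.
Qed.

Lemma box_comparison_super (R : realType) (s b r : R) (u : R * R -> R)
    (phi phix phixx phit : R -> R -> R) (x1 x2 t1 t2 dl : R) :
  0 <= s -> 0 <= r -> 0 < dl -> continuous u -> C12 phi phix phixx phit ->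
  (forall x t, x1 < x < x2 -> t1 < t <= t2 -> heat_approx s b r (fun v => 0 <= v) u x t) ->
  (forall x t, x1 <= x <= x2 -> t1 <= t <= t2 -> heat s b r phi phix phixx phit x t <= - dl) ->
  (forall x, x1 <= x <= x2 -> phi x t1 <= u (x, t1)) ->
  (forall t, t1 <= t <= t2 -> phi x1 t <= u (x1, t)) ->
  (forall t, t1 <= t <= t2 -> phi x2 t <= u (x2, t)) ->
  forall x t, x1 <= x <= x2 -> t1 <= t <= t2 -> phi x t <= u (x, t).
Proof.
move=> s0 r0 dl0 cu Cphi sub hphi bot lft rgt x t hx ht.
have cu' : continuous (fun z => - u z) by move=> z; apply: continuousN; exact: cu.
have := box_comparison_sub s0 r0 dl0 cu' (C12Z (-1) Cphi) _ _ _ _ _ hx ht.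
rewrite mulN1r lerN2; apply.
- move=> x' t' h1 h2 _; apply: heat_approx_opp (sub _ _ h1 h2) => v.
  by rewrite oppr_le0.
- move=> x' t' h1 h2; have := hphi _ _ h1 h2; rewrite /heat; clear; lra.
- by move=> x' h; rewrite mulN1r lerN2; exact: bot.
- by move=> x' h; rewrite mulN1r lerN2; exact: lft.
- by move=> x' h; rewrite mulN1r lerN2; exact: rgt.
Qed.

(** * Comparison on a half strip unbounded to the left *)

Lemma is_derive_exp_affine (R : realType) (a c x : R) :
  is_derive x 1 (fun x => expR (a * x + c)) (a * expR (a * x + c)).
Proof.
have d1 : is_derive x 1 (fun x : R => a * x + c) (a + 0).
  have h := is_deriveZ a (is_derive_id (x : R) (1 : R)).
  apply: is_derive_eq (is_deriveD h (is_derive_cst c (x : R) (1 : R))) _.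
  by rewrite /GRing.scale/= mulr1.
have := @is_derive1_comp R expR (fun x => a * x + c) x _ _ (is_derive_expR _) d1.
by rewrite addr0 mulrC.
Qed.

Lemma C12_exp (R : realType) (a e c : R) :
  C12 (fun x t => expR (a * x + e * t + c)) (fun x t => a * expR (a * x + e * t + c))
    (fun x t => a * (a * expR (a * x + e * t + c))) (fun x t => e * expR (a * x + e * t + c)).
Proof.
have d1 x := is_derive_exp_affine a c x.
have d2 (x : R) : is_derive x 1 (fun x => a * expR (a * x + c)) (a * (a * expR (a * x + c))).
  exact: (@is_deriveZ R R R (fun x => expR (a * x + c)) a x 1 _ (d1 x)).
have d3 t := is_derive_exp_affine e 0 t.
have := C12_tensor d1 d2 d3.
have E x t : expR (a * x + e * t + c) = expR (a * x + c) * expR (e * t + 0).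
  by rewrite -expRD; congr expR; ring.
by congr C12; apply/funext => x; apply/funext => t; rewrite E; ring.
Qed.

(** The barrier [C + ep * exp(-x + la * t)] overtakes the bound [M] far to the left, which reduces
    the claim to a box. *)
Lemma strip_comparison (R : realType) (s b r B T C M : R) (u : R * R -> R) :
  0 <= s -> 0 <= r -> 0 <= C -> continuous u ->
  (forall z, u z <= M) ->
  (forall x t, x < B -> 0 < t <= T -> C < u (x, t) ->
     heat_approx s b r (fun v => v <= 0) u x t) ->
  (forall x, x <= B -> u (x, 0) <= C) ->
  (forall t, 0 <= t <= T -> u (B, t) <= C) ->
  forall x t, x <= B -> 0 <= t <= T -> u (x, t) <= C.
Proof.
move=> s0 r0 C0 cu uM sub bot rgt x t xB ht.
(* Makes the rate [la - s + b + r] produced by [heat] on the exponential at least 1. *)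
pose la := s + `|b| + 1.
have la0 : 0 <= la by rewrite /la; have := normr_ge0 b; clear -s0; lra.
rewrite leNgt; apply/negP => Cu.
pose E (x t : R) := expR (- 1 * x + la * t + 0).
have E0 x' t' : 0 < E x' t' by exact: expR_gt0.
(* At the supposed bad point the barrier then accounts for only half of the excess over [C]. *)
pose ep := (u (x, t) - C) / (2 * E x t).
have ep0 : 0 < ep by rewrite divr_gt0 ?subr_gt0// mulr_gt0.
have epE : ep * E x t = (u (x, t) - C) / 2.
  by rewrite /ep; field; rewrite gt_eqF.
have Cphi := C12D (C12_cst C) (C12Z ep (C12_exp (- 1) la 0)).
pose x1 := Num.min x (- (`|M| / ep)).
have x1x : x1 <= x by rewrite ge_min lexx.
have x1M : x1 <= - (`|M| / ep) by rewrite ge_min lexx orbT.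
have Elow x' t' : 0 <= t' -> 1 - x' <= E x' t'.
  move=> t'0; apply: le_trans (expR_ge1Dx _).
  have : 0 <= la * t' by rewrite mulr_ge0.
  by clear; lra.
have dl0 : 0 < ep * expR (- B) by rewrite mulr_gt0// expR_gt0.
suff : u (x, t) <= C + ep * E x t by rewrite epE; clear -Cu; lra.
apply: (box_comparison_sub s0 r0 dl0 cu Cphi (x1 := x1) (x2 := B) (t1 := 0) (t2 := T)) => //;
  last by rewrite x1x.
- move=> x' t' /andP[_ h1] h2 h3; apply: sub => //; apply: le_lt_trans h3.
  by rewrite lerDl mulr_ge0 ?(ltW ep0)// expR_ge0.
- move=> x' t' /andP[_ h1] /andP[h2 _]; rewrite /heat -/(E x' t').
  have e1 : expR (- B) <= E x' t'.
    rewrite /E ler_expR; have : 0 <= la * t' by rewrite mulr_ge0.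
    by clear -h1; lra.
  have e2 : ep * expR (- B) <= ep * E x' t' by apply: ler_wpM2l => //; exact: ltW.
  have e3 : 0 < ep * E x' t' by rewrite mulr_gt0.
  have e4 : 0 <= ep * E x' t' * (`|b| + b + r).
    apply: mulr_ge0; first exact: ltW.
    by have := ler_norm (- b); rewrite normrN; clear -r0; lra.
  have e5 : 0 <= r * C by rewrite mulr_ge0.
  by move: e2 e4 e5; rewrite /la; clear; nra.
- move=> x' /andP[_ h1]; apply: (le_trans (bot _ h1)).
  by rewrite lerDl mulr_ge0 ?(ltW ep0)// expR_ge0.
- move=> t' /andP[h1 _]; apply: (le_trans (uM _)).
  have h := Elow x1 t' h1.
  have : ep * (1 - x1) <= ep * E x1 t' by apply: ler_wpM2l => //; exact: ltW.
  have : `|M| <= - x1 * ep by rewrite -ler_pdivrMr//; move: x1M; clear; lra.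
  by have := ler_norm M; rewrite -/(E x1 t'); clear -C0 ep0; lra.
- move=> t' h; apply: (le_trans (rgt _ h)).
  by rewrite lerDl mulr_ge0 ?(ltW ep0)// expR_ge0.
Qed.

(** * The obstacle problem *)

(** The facts about the solution on which the free boundary argument rests. Continuity and the bound
    are global because [y] will be an extension of the solution to the whole plane. *)
Record obstacle_solution (R : realType) (s b r L T M : R) (psi : R -> R)
    (y : R * R -> R) : Prop := {
  os_cont : continuous y;
  os_bound : forall z, `|y z| <= M;
  os_ge : forall x t, x <= L -> 0 <= t <= T -> psi x <= y (x, t);
  os_init : forall x, x <= L -> y (x, 0) = psi x;
  os_bdry : forall t, 0 <= t <= T -> y (L, t) = psi L;
  os_super : forall x t, x < L -> 0 < t <= T -> heat_approx s b r (fun v => 0 <= v) y x t;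
  os_eq : forall x t, x < L -> 0 < t <= T -> psi x < y (x, t) ->
    heat_approx s b r (fun v => v = 0) y x t }.

(** Above [psi L] the solution is off the monotone obstacle, hence solves the equation there, and a
    nonnegative constant is a supersolution. *)
Lemma obstacle_solution_le (R : realType) (s b r L T M : R) (psi : R -> R) y :
  0 <= s -> 0 <= r -> 0 <= psi L -> {homo psi : x x' / x <= x'} ->
  obstacle_solution s b r L T M psi y ->
  forall x t, x <= L -> 0 <= t <= T -> y (x, t) <= psi L.
Proof.
move=> s0 r0 psi0 npsi os.
apply: (strip_comparison (s := s) (b := b) (r := r) (M := M)) => //.
- exact: os_cont os.
- by move=> z; apply: le_trans (ler_norm _) (os_bound os z).
- move=> x t xL ht hlt; apply: heat_approx_weaken (os_eq os xL ht _); first by move=> v ->.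
  by apply: le_lt_trans hlt; apply: npsi; exact: ltW.
- by move=> x xL; rewrite (os_init os xL) npsi.
- by move=> t ht; rewrite (os_bdry os ht).
Qed.

Lemma continuous_shift_sub (R : realType) (y : R * R -> R) (h k : R) : continuous y ->
  continuous (fun z : R * R => y (z.1 + h, z.2 + k) - y z).
Proof.
move=> cy z; apply: (@continuousB _ _ _ (fun z : R * R => y (z.1 + h, z.2 + k)) y z _ (cy z)).
apply: (@continuous_comp _ _ _ (fun z : R * R => (z.1 + h, z.2 + k)) y z); last exact: cy.
have c1 : (fun z : R * R => z.1 + h) @ z --> z.1 + h.
  by apply: cvgD; [exact: cvg_fst|exact: cvg_cst].
have c2 : (fun z : R * R => z.2 + k) @ z --> z.2 + k.
  by apply: cvgD; [exact: cvg_snd|exact: cvg_cst].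
exact: (cvg_pair c1 c2).
Qed.

(** Let [u] be [y] minus its translate. Where [u > 0], [y] exceeds [psi (x + h) >= psi x], so [y]
    solves the equation, the translate is a supersolution and [u] a subsolution. At [t = 0]
    monotonicity of [psi] gives the sign; at [x = L - h] the translate takes the maximal value
    [psi L]. *)
Lemma obstacle_solution_mono (R : realType) (s b r L T M : R) (psi : R -> R) y (h k : R) :
  0 <= s -> 0 <= r -> 0 <= psi L -> {homo psi : x x' / x <= x'} ->
  obstacle_solution s b r L T M psi y -> 0 <= h -> 0 <= k <= T ->
  forall x t, x <= L - h -> 0 <= t <= T - k -> y (x, t) <= y (x + h, t + k).
Proof.
move=> s0 r0 psi0 npsi os h0 hk x t hx ht.
have ub := obstacle_solution_le s0 r0 psi0 npsi os.
pose u (z : R * R) := - (y (z.1 + h, z.2 + k) - y z).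
suff : u (x, t) <= 0 by rewrite /u/=; clear; lra.
apply: (strip_comparison (s := s) (b := b) (r := r) (M := 2 * M) (B := L - h) (T := T - k)) => //.
- move=> z; rewrite /u.
  by have := @continuousN _ _ _ _ z (@continuous_shift_sub R y h k (os_cont os) z).
- move=> z; rewrite /u.
  have := os_bound os z; have := os_bound os (z.1 + h, z.2 + k).
  by rewrite !ler_norml; clear; lra.
- move=> x' t' hx' ht' hu.
  apply: (heat_approx_opp (P := fun v => 0 <= v)) => [v|]; first by rewrite oppr_le0.
  have g : psi x' <= y (x' + h, t' + k).
    apply: le_trans (os_ge os _ _); first by apply: npsi; clear -h0; lra.
      by clear -hx'; lra.
    by clear -ht' hk; lra.
  apply: (heat_approx_shift_sub (P1 := fun v => 0 <= v) (P2 := fun v => v = 0)).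
  - by move=> v w v0 ->; rewrite subr0.
  - by apply: (os_super os); [clear -hx'; lra|clear -ht' hk; lra].
  - apply: (os_eq os); [clear -hx' h0; lra|clear -ht' hk; lra|].
    by apply: le_lt_trans g _; move: hu; rewrite /u/=; clear; lra.
- move=> x' hx'; rewrite /u/= add0r (os_init os); last by clear -hx' h0; lra.
  have : psi x' <= psi (x' + h) by apply: npsi; clear -h0; lra.
  have := os_ge os (x := x' + h) (t := k).
  move=> /(_ _ hk); have -> : (x' + h <= L) by clear -hx'; lra.
  by move=> /(_ isT); clear; lra.
- move=> t' ht'; rewrite /u/= subrK (os_bdry os); last by clear -ht' hk; lra.
  have := ub (L - h) t'.
  have -> : (L - h <= L) by clear -h0; lra.
  have -> : (0 <= t' <= T) by clear -ht' hk; lra.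
  by move=> /(_ isT isT); clear; lra.
Qed.

(** * Local barrier arguments at and near the contact set *)

Lemma no_convex_kink (R : realType) (s b r c ka rho x0 t0 : R) (y : R * R -> R) :
  0 < s -> 0 <= r -> 0 < ka -> 0 < rho -> continuous y ->
  heat_approx s b r (fun v => 0 <= v) y x0 t0 -> y (x0, t0) = c ->
  (forall x t, box (x0 - rho) (x0 + rho) (t0 - rho) t0 (x, t) -> c <= y (x, t)) ->
  (forall x t, box (x0 - rho) (x0 + rho) (t0 - rho) t0 (x, t) -> c + ka * (x - x0) <= y (x, t)) ->
  False.
Proof.
move=> s0 r0 ka0 rho0 cy hy yc ge1 ge2.
(* The test function is [c + (ka / 2) * (x - x0) + B * (x - x0)^2]. This [B] lets [2 * s * B] absorb
   the lower order terms, so that [heat] is at most -1. *)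
pose B := (1 + 2 * `|b| * ka + r * (`|c| + ka)) / (2 * s).
have b0 := normr_ge0 b; have c0 := normr_ge0 c.
have num0 : 1 <= 1 + 2 * `|b| * ka + r * (`|c| + ka).
  have m1 : 0 <= `|b| * ka by rewrite mulr_ge0// ltW.
  have m2 : 0 <= r * (`|c| + ka) by rewrite mulr_ge0// addr_ge0// ltW.
  by clear -m1 m2; lra.
have BE : B * (2 * s) = 1 + 2 * `|b| * ka + r * (`|c| + ka).
  by rewrite /B divfK// gt_eqF// mulr_gt0.
have B0 : 0 < B.
  by rewrite /B divr_gt0 ?mulr_gt0//; clear -num0; lra.
clearbody B.
have B20 : 0 < 2 * B by rewrite mulr_gt0.
(* For |x - x0| at most [ka / (2 * B)] the parabola lies below both [c] plus 0 on the left and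
   [c + ka * (x - x0)] on the right. *)
pose ro := Num.min 1 (Num.min rho (ka / (2 * B))).
have ro0 : 0 < ro by rewrite !lt_min ltr01 rho0 divr_gt0// mulr_gt0.
have ro1 : ro <= 1 by rewrite ge_min lexx.
have roA : ro <= rho by rewrite !ge_min lexx !orbT.
have roB : ro * (2 * B) <= ka by rewrite -ler_pdivlMr; [rewrite /ro !ge_min lexx !orbT|rewrite mulr_gt0].
have hy' : heat_approx s b r (fun v => v <= 0) (fun z => - y z) x0 t0.
  by apply: heat_approx_opp hy => v; rewrite oppr_le0.
have sub x t : box (x0 - ro) (x0 + ro) (t0 - ro) t0 (x, t) ->
    box (x0 - rho) (x0 + rho) (t0 - rho) t0 (x, t).
  by rewrite /box/= => h; clear -h roA; lra.
have Cphi := C12Z (-1) (C12_quadratic x0 t0 c (ka / 2) B 0).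
apply: (no_touching_from_above (ltW s0) r0 hy' Cphi ltr01 ro0).
- by rewrite yc !subrr; ring.
- move=> x t h; have h1 := ge1 _ _ (sub _ _ h); have h2 := ge2 _ _ (sub _ _ h).
  rewrite mulN1r lerN2 mul0r addr0.
  move: h; rewrite /box/= => /andP[/andP[k1 k2] _].
  have [x0x|xx0] := leP x0 x.
    apply: le_trans h2.
    have : (x - x0) * (x - x0) * (2 * B) <= (x - x0) * ka.
      rewrite -mulrA; apply: ler_wpM2l; first by clear -x0x; lra.
      apply: le_trans roB; apply: ler_wpM2r; first by clear -B0; lra.
      by clear -k2; lra.
    by clear; nra.
  apply: le_trans h1.
  have : (x0 - x) * (x0 - x) * (2 * B) <= (x0 - x) * ka.
    rewrite -mulrA; apply: ler_wpM2l; first by clear -xx0; lra.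
    apply: le_trans roB; apply: ler_wpM2r; first by clear -B0; lra.
    by clear -k1; lra.
  by clear; nra.
move=> x t; rewrite /box/= => /andP[/andP[k1 k2] _]; rewrite /heat mul0r addr0.
pose d := x - x0.
have hd : `|d| <= ro by rewrite /d ler_norml; clear -k1 k2; lra.
have Bd : `|2 * B * d| <= ka.
  rewrite normrM (gtr0_norm B20); apply: le_trans roB; rewrite mulrC.
  by apply: ler_wpM2r => //; clear -B0; lra.
have bd : - (b * (ka / 2 + 2 * B * d)) <= 2 * `|b| * ka.
  apply: (le_trans (ler_norm _)); rewrite normrN normrM.
  have : `|b| * `|ka / 2 + 2 * B * d| <= `|b| * (2 * ka).
    apply: ler_wpM2l => //; apply: (le_trans (ler_normD _ _)).
    by rewrite (gtr0_norm (x := ka / 2)) ?divr_gt0//; clear -Bd ka0; lra.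
  by clear; lra.
have rd : r * (c + ka / 2 * d + B * d ^+ 2) <= r * (`|c| + ka).
  apply: ler_wpM2l => //.
  have h1 : ka / 2 * d <= ka / 2.
    rewrite ler_piMr//; first by clear -ka0; lra.
    by apply: le_trans (ler_norm _) _; clear -hd ro1; lra.
  have h2 : B * d ^+ 2 <= ka / 2.
    have : `|2 * B * d| * `|d| <= ka * 1.
      by apply: ler_pM => //; clear -hd ro1; lra.
    rewrite -normrM => /(le_trans (ler_norm _)); clear; nra.
  by have := ler_norm c; clear -h1 h2; lra.
by move: BE bd rd; rewrite -/d; clear -num0; nra.
Qed.

Lemma continuous_slice (R : realType) (y : R * R -> R) (x : R) : continuous y ->
  continuous (fun t => y (x, t)).
Proof.
move=> cy t; apply: (@continuous_comp _ _ _ (fun t : R => (x, t)) y t); last exact: cy.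
have c1 : (fun _ : R => x) @ t --> x by exact: cvg_cst.
have c2 : (fun t : R => t) @ t --> t by exact: cvg_id.
exact: (cvg_pair c1 c2).
Qed.

Lemma continuous_near_le (R : realType) (f : R -> R) (t0 e : R) : continuous f -> 0 < e ->
  exists2 d, 0 < d & forall t, `|t - t0| <= d -> `|f t - f t0| <= e.
Proof.
move=> cf e0; have /cvgrPdist_le/(_ _ e0)[d /= d0 H] := cf t0.
exists (d / 2); first by rewrite divr_gt0.
move=> t ht; rewrite distrC; apply: H => /=; rewrite distrC.
by apply: le_lt_trans ht _; clear -d0; lra.
Qed.

(* A contact interval cannot be left instantaneously: the obstacle being a
   strict supersolution there, the parabola [c + B (x - m)^2 - ka (t - t0)]
   would push the solution below the obstacle. *)
Lemma contact_persists (R : realType) (s b r L T M c x1 x2 t0 t1 : R) (psi : R -> R) y :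
  0 <= s -> 0 < r -> 0 < c -> obstacle_solution s b r L T M psi y ->
  x1 < x2 -> x2 <= L -> 0 <= t0 -> t0 < t1 -> t1 <= T ->
  (forall x, x1 <= x <= x2 -> psi x = c) ->
  (forall x, x1 <= x <= x2 -> y (x, t0) = c) ->
  (forall x t, x1 < x < x2 -> t0 < t <= t1 -> c < y (x, t)) -> False.
Proof.
move=> s0 r0 c0 os x12 x2L t00 t01 t1T psic yc gtc.
have b0 := normr_ge0 b.
have cy := os_cont os.
pose m := (x1 + x2) / 2; pose d := (x2 - x1) / 2.
have d0 : 0 < d by rewrite /d; clear -x12; lra.
have rc0 : 0 < r * c by rewrite mulr_gt0.
(* Of the gain [r * c], one quarter pays for the terms in [B], one for the time slope [ka] and one
   for [r * ka * (t - t0) <= ka]; a quarter is left as the strict margin. *)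
pose S := 2 * s + 2 * `|b| * d + 1.
have S0 : 0 < S.
  have : 0 <= `|b| * d by rewrite mulr_ge0// ltW.
  by rewrite /S; clear -s0; lra.
pose B := r * c / (4 * S).
have B0 : 0 < B by rewrite divr_gt0// mulr_gt0.
have BS : B * S = r * c / 4 by rewrite /B; field; rewrite gt_eqF.
pose ka := r * c / 4.
have ka0 : 0 < ka by rewrite divr_gt0.
pose e := B * d ^+ 2 / 2.
have e0 : 0 < e by rewrite /e divr_gt0// mulr_gt0// exprn_gt0.
have [d1 d10 H1] := continuous_near_le t0 (continuous_slice (x := x1) cy) e0.
have [d2 d20 H2] := continuous_near_le t0 (continuous_slice (x := x2) cy) e0.
(* On the lateral sides [y] rises by at most [e] and the barrier loses at most [e], while it starts
   at [c + 2 * e]. *)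
pose et := Num.min (Num.min (t1 - t0) r^-1) (Num.min (Num.min d1 d2) (e / ka)).
have et0 : 0 < et by rewrite !lt_min subr_gt0 t01 invr_gt0 r0 d10 d20 divr_gt0.
have et1 : et <= t1 - t0 by rewrite !ge_min lexx.
have et2 : r * et <= 1.
  by rewrite mulrC -ler_pdivlMr// div1r /et !ge_min lexx !orbT.
have et3 : et <= d1 by rewrite !ge_min lexx !orbT.
have et4 : et <= d2 by rewrite !ge_min lexx !orbT.
have et5 : ka * et <= e by rewrite mulrC -ler_pdivlMr// /et !ge_min lexx !orbT.
have dl0 : 0 < r * c / 4 by [].
have Cphi := C12_quadratic m t0 c 0 B (- ka).
have inm : x1 <= m <= x2 by rewrite /m; clear -x12; lra.
have : y (m, t0 + et) <= c + 0 * (m - m) + B * (m - m) ^+ 2 + (- ka) * (t0 + et - t0).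
  apply: (box_comparison_sub (b := b) s0 (ltW r0) dl0 cy Cphi (x1 := x1) (x2 := x2) (t1 := t0) (t2 := t0 + et)) => //.
  - move=> x t hx ht _.
    apply: heat_approx_weaken (os_eq os _ _ _); first by move=> v ->.
    + by clear -hx x2L; lra.
    + by clear -ht t00 et1 t1T; lra.
    rewrite psic; last by clear -hx; lra.
    by apply: gtc => //; clear -ht et1; lra.
  - move=> x t hx ht; rewrite /heat.
    have hd : `|x - m| <= d by rewrite ler_norml /m /d; clear -hx; lra.
    have q0 : 0 <= r * (B * (x - m) ^+ 2).
      by apply: mulr_ge0; [exact: ltW|apply: mulr_ge0; [exact: ltW|exact: sqr_ge0]].
    have q1 : r * (ka * (t - t0)) <= ka.
      rewrite mulrCA -{2}[ka]mulr1; apply: ler_wpM2l; first exact: ltW.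
      apply: le_trans et2; apply: ler_wpM2l; first exact: ltW.
      by clear -ht; lra.
    have q2 : b * (2 * B * (x - m)) <= B * (2 * `|b| * d).
      have : B * (b * (x - m)) <= B * (`|b| * d).
        apply: ler_wpM2l; first exact: ltW.
        by apply: (le_trans (ler_norm _)); rewrite normrM; apply: ler_wpM2l.
      by clear; lra.
    move: q0 q1 q2 BS; rewrite /S /ka; clear -B0; nra.
  - move=> x hx; rewrite yc// mul0r addr0 subrr mulr0 addr0 lerDl mulr_ge0 ?sqr_ge0//.
    exact: ltW.
  - move=> t ht; have := H1 t; rewrite yc ?lexx ?(ltW x12)//.
    have -> : `|t - t0| <= d1 by rewrite ler_norml; clear -ht et3 d10; lra.
    move=> /(_ isT); rewrite ler_norml => /andP[_ h].
    have -> : x1 - m = - d by rewrite /m /d; field.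
    rewrite sqrrN.
    have : ka * (t - t0) <= ka * et by apply: ler_wpM2l; [exact: ltW|clear -ht; lra].
    by move: h et5; rewrite /e; clear; lra.
  - move=> t ht; have := H2 t; rewrite yc ?lexx ?(ltW x12)//.
    have -> : `|t - t0| <= d2 by rewrite ler_norml; clear -ht et4 d20; lra.
    move=> /(_ isT); rewrite ler_norml => /andP[_ h].
    have -> : x2 - m = d by rewrite /m /d; field.
    have : ka * (t - t0) <= ka * et by apply: ler_wpM2l; [exact: ltW|clear -ht; lra].
    by move: h et5; rewrite /e; clear; lra.
  by clear -et0; lra.
have := gtc m (t0 + et).
have -> : (x1 < m < x2) by rewrite /m; clear -x12; lra.
have -> : (t0 < t0 + et <= t1) by clear -et0 et1; lra.
move=> /(_ isT isT).
have : 0 < ka * et by rewrite mulr_gt0.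
by rewrite subrr expr0n/=; clear; lra.
Qed.

(* Barrier for spreading positivity forward in time: on the zero set of the
   parabola [g = 1 - ((x - x0) / rho)^2] the term [2 s g'^2] coming from
   [(g^2)''] is positive, which leaves room for a strict subsolution. *)
Lemma positivity_propagates (R : realType) (s b r x0 rho t1 t2 m : R) (D : R * R -> R) :
  0 < s -> 0 <= r -> 0 < rho -> 0 < m -> continuous D ->
  (forall x t, x0 - rho < x < x0 + rho -> t1 < t <= t2 -> heat_approx s b r (fun v => 0 <= v) D x t) ->
  (forall x t, x0 - rho <= x <= x0 + rho -> t1 <= t <= t2 -> 0 <= D (x, t)) ->
  (forall x, x0 - rho <= x <= x0 + rho -> m <= D (x, t1)) ->
  forall t, t1 <= t <= t2 -> 0 < D (x0, t).
Proof.
move=> s0 r0 rho0 m0 cD sD D0 Dm t ht.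
have b0 := normr_ge0 b.
pose w := rho ^- 2.
have rho20 : 0 < rho ^+ 2 by rewrite exprn_gt0.
have w0 : 0 < w by rewrite invr_gt0.
have wr : w * rho ^+ 2 = 1 by rewrite mulVf// gt_eqF.
(* Since [w * (x - x0)^2 = 1 - g], [heat] of the barrier is, up to a positive factor, at most
   [- (la - r) * g^2 + Bc * g - Cc]; [la] is chosen so that this quadratic never exceeds
   [- Cc / 2]. *)
pose Bc := 12 * s * w + 4 * `|b| * rho * w.
pose Cc := 8 * s * w.
have Cc0 : 0 < Cc by rewrite !mulr_gt0.
pose la := Bc ^+ 2 / (2 * Cc) + r.
have laE : (la - r) * (2 * Cc) = Bc ^+ 2.
  by rewrite /la addrK divfK// gt_eqF// mulr_gt0.
have la0 : 0 <= la - r by rewrite /la addrK divr_ge0 ?sqr_ge0// mulr_ge0// ltW.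
pose q : {poly R} := (1 - w *: ('X - x0%:P) ^+ 2) ^+ 2.
have dg (u : R) : is_derive u 1 (fun u => m * expR (- la * u + la * t1))
    (m * (- la * expR (- la * u + la * t1))).
  exact: (@is_deriveZ R R R (fun u => expR (- la * u + la * t1)) m u 1 _ (is_derive_exp_affine _ _ _)).
have Cphi := C12_poly_time q dg.
pose E (u : R) := expR (- la * u + la * t1).
have E0 u : 0 < E u by exact: expR_gt0.
have qE x : q.[x] = (1 - w * (x - x0) ^+ 2) ^+ 2 by rewrite /q !hornerE.
have q1E x : (deriv q).[x] = 2 * (1 - w * (x - x0) ^+ 2) * (- 2 * w * (x - x0)).
  by rewrite /q !(poly.derivE, hornerE)/=; ring.
have q2E x : (deriv (deriv q)).[x] = 2 * (2 * w * (x - x0)) ^+ 2 - 4 * w * (1 - w * (x - x0) ^+ 2).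
  by rewrite /q !(poly.derivE, hornerE)/=; ring.
have dl0 : 0 < m * E t2 * (Cc / 2) by rewrite !mulr_gt0// divr_gt0.
apply: (@lt_le_trans _ _ (q.[x0] * (m * E t))).
  by rewrite qE subrr expr0n/= mulr0 subr0 expr1n mul1r mulr_gt0.
apply: (box_comparison_super (b := b) (ltW s0) r0 dl0 cD Cphi (x1 := x0 - rho) (x2 := x0 + rho)
  (t1 := t1) (t2 := t2)) => //.
- move=> x u hx hu; rewrite /heat; cbv beta; rewrite qE q1E q2E -/(E u).
  pose g := 1 - w * (x - x0) ^+ 2.
  pose d := x - x0.
  have hd : `|d| <= rho by rewrite ler_norml /d; clear -hx; lra.
  have d2 : w * d ^+ 2 = 1 - g by rewrite /g /d; ring.
  have g0 : 0 <= g.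
    have : w * d ^+ 2 <= w * rho ^+ 2.
      apply: ler_wpM2l; first exact: ltW.
      by rewrite -real_normK ?num_real// ler_pXn2r// nnegrE ltW.
    by rewrite wr d2; clear; lra.
  have bd : b * d <= `|b| * rho.
    by apply: (le_trans (ler_norm _)); rewrite normrM; apply: ler_wpM2l.
  have gw : 0 <= g * w by rewrite mulr_ge0// ltW.
  have bdg : g * w * (b * d) <= g * w * (`|b| * rho) by apply: ler_wpM2l.
  (* AM-GM: [Bc g <= (la - r) g^2 + Cc / 2] *)
  have key : - (la - r) * g ^+ 2 + Bc * g - Cc <= - (Cc / 2).
    rewrite -(ler_pM2r (x := 2 * Cc)) ?mulr_gt0//.
    have : 0 <= (Bc * g - Cc) ^+ 2 by exact: sqr_ge0.
    have -> : (- (la - r) * g ^+ 2 + Bc * g - Cc) * (2 * Cc) =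
       - ((la - r) * (2 * Cc)) * g ^+ 2 + (Bc * g - Cc) * (2 * Cc) by ring.
    by rewrite laE; clear; nra.
  have main : - la * g ^+ 2 - s * (2 * (2 * w * d) ^+ 2 - 4 * w * g)
      - b * (2 * g * (- 2 * w * d)) + r * g ^+ 2 <= - (Cc / 2).
    apply: le_trans key.
    have -> : (2 * w * d) ^+ 2 = 4 * w * (1 - g) by rewrite -d2; ring.
    by move: bdg; rewrite /Bc /Cc; clear; lra.
  have Et : E t2 <= E u.
    rewrite /E ler_expR; have : 0 <= la * (t2 - u).
      by rewrite mulr_ge0//; [clear -la0 r0; lra|clear -hu; lra].
    by clear; lra.
  rewrite -/d -/g.
  have -> : g ^+ 2 * (m * (- la * E u)) - s * ((2 * (2 * w * d) ^+ 2 - 4 * w * g) * (m * E u))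
      - b * (2 * g * (- 2 * w * d) * (m * E u)) + r * (g ^+ 2 * (m * E u)) =
     m * E u * (- la * g ^+ 2 - s * (2 * (2 * w * d) ^+ 2 - 4 * w * g)
      - b * (2 * g * (- 2 * w * d)) + r * g ^+ 2) by ring.
  apply: (@le_trans _ _ (m * E u * (- (Cc / 2)))).
    by apply: ler_wpM2l => //; rewrite mulr_ge0// ltW.
  rewrite mulrN lerN2; apply: ler_wpM2r; first by rewrite divr_ge0// ltW.
  by apply: ler_wpM2l => //; exact: ltW.
- move=> x hx; apply: le_trans (Dm x hx).
  have -> : m * expR (- la * t1 + la * t1) = m by rewrite mulNr addNr expR0 mulr1.
  rewrite qE; apply: ler_piMl; first exact: ltW.
  have h : 0 <= w * (x - x0) ^+ 2 <= 1.
    rewrite mulr_ge0 ?sqr_ge0 ?(ltW w0)//= -wr; apply: ler_wpM2l; first exact: ltW.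
    rewrite -real_normK ?num_real// ler_pXn2r ?nnegrE ?(ltW rho0)//.
    by rewrite ler_norml; clear -hx; lra.
  by rewrite expr_le1//; clear -h; lra.
- move=> u hu; have -> : q.[x0 - rho] = 0.
    by rewrite qE addrAC subrr add0r sqrrN wr subrr expr0n.
  by rewrite mul0r; apply: D0 => //; clear -rho0; lra.
- move=> u hu; have -> : q.[x0 + rho] = 0.
    by rewrite qE addrAC subrr add0r wr subrr expr0n.
  by rewrite mul0r; apply: D0 => //; clear -rho0; lra.
by clear -rho0; lra.
Qed.

(* Hopf's lemma, with the moving front [ep * (exp (la (x - a + k (t - t2))) - 1)],
   negative on the bottom side, as barrier. *)
Lemma linear_growth_at_left_end (R : realType) (s b r a l th m : R) :
  0 < s -> 0 < r -> a < l -> 0 < th -> 0 < m ->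
  exists2 ka, 0 < ka & forall (D : R * R -> R) t2, continuous D ->
  (forall x t, a < x < l -> t2 - th < t <= t2 -> heat_approx s b r (fun v => 0 <= v) D x t) ->
  (forall x t, a <= x <= l -> t2 - th <= t <= t2 -> 0 <= D (x, t)) ->
  (forall t, t2 - th <= t <= t2 -> m <= D (l, t)) ->
  forall x, a <= x <= l -> ka * (x - a) <= D (x, t2).
Proof.
move=> s0 r0 al th0 m0.
have b0 := normr_ge0 b.
pose d := l - a.
have d0 : 0 < d by rewrite subr_gt0.
(* At this speed the front crosses the whole interval in time [th], so the barrier is nonpositive on
   the entire bottom side. *)
pose k := d / th.
have k0 : 0 < k by rewrite divr_gt0.
have kth : k * th = d by rewrite divfK// gt_eqF.
(* Large enough for the diffusion term [s * la^2] to dominate [la * k - b * la + r]. *)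
pose la := (k + `|b| + r) / s + 1.
have las : (la - 1) * s = k + `|b| + r by rewrite /la addrK divfK// gt_eqF.
have la1 : 1 <= la.
  by rewrite /la lerDr divr_ge0 ?(ltW s0)// !addr_ge0// ltW.
have lap : la * k - s * la ^+ 2 - b * la + r <= 0.
  have h1 : - b * la <= `|b| * la.
    by apply: ler_wpM2r; [clear -la1; lra|rewrite -normrN ler_norm].
  have h2 : (k + `|b| + r) * la <= s * la * la.
    by apply: ler_wpM2r; [clear -la1; lra|move: las; clear -s0; lra].
  have h3 : r <= r * la by rewrite ler_peMr// ltW.
  by move: h1 h2 h3; clear; lra.
(* Keeps the barrier below [m] at [x = l]. The slope [ep * la] depends neither on [D] nor on [t2],
   so it serves for a whole range of times. *)
pose ep := m * expR (- (la * d)).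
have ep0 : 0 < ep by rewrite mulr_gt0// expR_gt0.
exists (ep * la); first by rewrite mulr_gt0//; clear -la1; lra.
move=> D t2 cD sD D0 Dm x hx.
have dl0 : 0 < ep * r by rewrite mulr_gt0.
pose E (x t : R) := expR (la * x + la * k * t + - (la * a + la * k * t2)).
have EE x' t' : E x' t' = expR (la * (x' - a + k * (t' - t2))).
  by rewrite /E; congr expR; ring.
have Cphi := C12D (C12_cst (- ep)) (C12Z ep (C12_exp la (la * k) (- (la * a + la * k * t2)))).
have : - ep + ep * E x t2 <= D (x, t2).
  apply: (box_comparison_super (b := b) (ltW s0) (ltW r0) dl0 cD Cphi (x1 := a) (x2 := l)
    (t1 := t2 - th) (t2 := t2)) => //.
  - move=> x' t' hx' ht'; rewrite /heat -/(E x' t').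
    have : ep * E x' t' * (la * k - s * la ^+ 2 - b * la + r) <= 0.
      by rewrite mulr_ge0_le0// mulr_ge0 ?(ltW ep0)// expR_ge0.
    by clear; lra.
  - move=> x' hx'; apply: (@le_trans _ _ 0); last first.
      by apply: D0 => //; clear -th0; lra.
    rewrite -/(E x' (t2 - th)) EE.
    have : expR (la * (x' - a + k * (t2 - th - t2))) <= 1.
      rewrite -expR0 ler_expR mulr_ge0_le0//; first by clear -la1; lra.
      by move: kth; rewrite /d; clear -hx'; lra.
    move=> h; have : ep * expR (la * (x' - a + k * (t2 - th - t2))) <= ep * 1.
      by apply: ler_wpM2l => //; exact: ltW.
    by clear; lra.
  - move=> t' ht'; apply: (@le_trans _ _ 0); last first.
      by apply: D0 => //; clear -al; lra.
    rewrite -/(E a t') EE.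
    have : expR (la * (a - a + k * (t' - t2))) <= 1.
      rewrite -expR0 ler_expR mulr_ge0_le0//; first by clear -la1; lra.
      rewrite subrr add0r mulr_ge0_le0//; first exact: ltW.
      by clear -ht'; lra.
    move=> h; have : ep * expR (la * (a - a + k * (t' - t2))) <= ep * 1.
      by apply: ler_wpM2l => //; exact: ltW.
    by clear; lra.
  - move=> t' ht'; apply: le_trans (Dm t' ht').
    rewrite -/(E l t') EE.
    have h : expR (la * (l - a + k * (t' - t2))) <= expR (la * d).
      rewrite ler_expR; apply: ler_wpM2l; first by clear -la1; lra.
      have : k * (t' - t2) <= 0 by rewrite mulr_ge0_le0 ?(ltW k0)//; clear -ht'; lra.
      by rewrite /d; clear; lra.
    have : ep * expR (la * (l - a + k * (t' - t2))) <= ep * expR (la * d).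
      by apply: ler_wpM2l => //; exact: ltW.
    have -> : ep * expR (la * d) = m.
      by rewrite /ep -mulrA -expRD addNr expR0 mulr1.
    by clear -ep0; lra.
  by clear -th0; lra.
rewrite EE subrr mulr0 addr0; apply: le_trans.
have := expR_ge1Dx (la * (x - a)) => h.
have : ep * (1 + la * (x - a)) <= ep * expR (la * (x - a)).
  by apply: ler_wpM2l => //; exact: ltW.
by clear; lra.
Qed.

(** A contact at [l] would transmit the convex kink of the obstacle to [y]: at least [c] on the
    left, slope at least [k0] on the right. *)
Lemma obstacle_solution_gt_kink (R : realType) (s b r L T M c l k0 : R) (psi : R -> R) y :
  0 < s -> 0 <= r -> 0 < k0 -> l < L -> {homo psi : x x' / x <= x'} -> 
  obstacle_solution s b r L T M psi y ->
  (forall x, x <= l -> psi x = c) -> (forall x, l <= x -> c + k0 * (x - l) <= psi x) ->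
  forall t, 0 < t <= T -> c < y (l, t).
Proof.
move=> s0 r0 k00 lL npsi os psic psik t /andP[t0 tT].
have psige x : c <= psi x.
  have [/psic->//|/ltW lx] := leP x l.
  by rewrite -(psic l) ?lexx// npsi.
rewrite lt_neqAle; apply/andP; split; last first.
  apply: (le_trans (psige l)); apply: (os_ge os); first exact: ltW.
  by rewrite (ltW t0).
apply/negP => /eqP yc.
pose ro := Num.min (L - l) t.
have ro0 : 0 < ro by rewrite lt_min subr_gt0 lL.
have roL : ro <= L - l by rewrite ge_min lexx.
have rot : ro <= t by rewrite ge_min lexx orbT.
have yge x u : box (l - ro) (l + ro) (t - ro) t (x, u) -> psi x <= y (x, u).
  by rewrite /box/= => h; apply: (os_ge os); clear -h roL rot tT; lra.
apply: (no_convex_kink s0 r0 k00 ro0 (os_cont os) (os_super os lL _) (esym yc)).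
- by rewrite t0.
- by move=> x u /yge; apply: le_trans.
move=> x u /yge; apply: le_trans.
have [lx|/ltW xl] := leP l x; first exact: psik.
apply: le_trans (psige x); rewrite gerDl mulr_ge0_le0//; first exact: ltW.
by clear -xl; lra.
Qed.

(* On a vertical piece of the boundary the time increment [D] of the solution
   would grow linearly away from it by Hopf's lemma, hence so would the
   solution, contradicting [no_convex_kink]. *)
Lemma free_boundary_not_vertical (R : realType) (s b r L T M c l k0 a s1 t1 : R)
    (psi : R -> R) y :
  0 < s -> 0 < r -> 0 < c -> 0 < k0 -> l < L -> {homo psi : x x' / x <= x'} ->
  continuous psi -> obstacle_solution s b r L T M psi y ->
  (forall x, x <= l -> psi x = c) -> (forall x, l <= x -> c + k0 * (x - l) <= psi x) ->
  a < l -> 0 < s1 -> s1 < t1 -> t1 <= T ->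
  (forall t, s1 <= t <= t1 -> y (a, t) = c) ->
  (forall x t, a < x <= l -> s1 <= t <= t1 -> c < y (x, t)) -> False.
Proof.
move=> s0 r0 c0 k00 lL npsi cpsi os psic psik al s10 st1 t1T yac ygt.
have kink := obstacle_solution_gt_kink s0 (ltW r0) k00 lL npsi os psic psik.
have psige x : c <= psi x.
  have [/psic->//|/ltW lx] := leP x l.
  by rewrite -(psic l) ?lexx// npsi.
have psiL0 : 0 <= psi L by apply: le_trans (psige L); exact: ltW.
have mono k := obstacle_solution_mono (h := 0) (k := k) (ltW s0) (ltW r0) psiL0 npsi os (lexx 0).
have cy := os_cont os.
pose h := (t1 - s1) / 2.
have h0 : 0 < h by rewrite /h; clear -st1; lra.
have t1E : t1 = s1 + h + h by rewrite /h; field.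
have hT : 0 <= h <= T by clear -h0 t1E t1T s10; lra.
pose D (z : R * R) := y (z.1 + 0, z.2 + h) - y z.
have cD : continuous D := continuous_shift_sub cy.
have DE x t : D (x, t) = y (x, t + h) - y (x, t) by rewrite /D/= addr0.
have D0 x t : x <= L -> 0 <= t <= T - h -> 0 <= D (x, t).
  by move=> hx ht; rewrite /D subr_ge0; apply: mono => //; rewrite subr0.
have sD x t : x < L -> 0 < t <= T - h -> psi x < y (x, t) ->
    heat_approx s b r (fun v => 0 <= v) D x t.
  move=> hx ht hy.
  apply: (heat_approx_shift_sub (P1 := fun v => 0 <= v) (P2 := fun v => v = 0)).
  - by move=> v w v0 ->; rewrite subr0.
  - by apply: (os_super os); rewrite ?addr0//; clear -ht h0; lra.
  by apply: (os_eq os) => //; clear -ht h0; lra.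
have Dl0 : 0 < D (l, 0).
  rewrite DE add0r (os_init os) ?(ltW lL)// psic// subr_gt0; apply: kink.
  by rewrite h0; case/andP: hT.
have [d d0 Hd] := continuous_near_le 0 (continuous_slice (x := l) cD) (e := D (l, 0) / 2)
  ltac:(by rewrite divr_gt0).
(* At time 0 the value at [l] is that of the obstacle and gives no equation; at the small time [ta]
   the increment is still positive and [kink] has already lifted [y] off the obstacle. *)
pose ta := Num.min d s1.
have ta0 : 0 < ta by rewrite lt_min d0.
have tad : ta <= d by rewrite ge_min lexx.
have tas : ta <= s1 by rewrite ge_min lexx orbT.
have Dta : 0 < D (l, ta).
  have := Hd ta; rewrite subr0 gtr0_norm// => /(_ tad); rewrite ler_norml.
  by clear -Dl0; lra.
have yta : c < y (l, ta) by apply: kink; clear -ta0 tas st1 t1T; lra.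
have cx (f : R * R -> R) t : continuous f -> continuous (fun x => f (x, t)).
  move=> cf x; apply: (@continuous_comp _ _ _ (fun x : R => (x, t)) f x); last exact: cf.
  have c1 : (fun x : R => x) @ x --> x by exact: cvg_id.
  have c2 : (fun _ : R => t) @ x --> t by exact: cvg_cst.
  exact: (cvg_pair c1 c2).
have [d1 d10 H1] := continuous_near_le l (cx D ta cD) (e := D (l, ta) / 2)
  ltac:(by rewrite divr_gt0).
have cyp : continuous (fun x => y (x, ta) - psi x).
  by move=> x; exact: (@continuousB _ _ _ (fun x => y (x, ta)) psi x (cx y ta cy x) (cpsi x)).
have [d2 d20 H2] := continuous_near_le l cyp (e := (y (l, ta) - c) / 2)
  ltac:(by rewrite divr_gt0// subr_gt0).
pose ro := Num.min (Num.min d1 d2) ((L - l) / 2).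
have ro0 : 0 < ro by rewrite !lt_min d10 d20 divr_gt0// subr_gt0.
have ro1 : ro <= d1 by rewrite !ge_min lexx.
have ro2 : ro <= d2 by rewrite !ge_min lexx orbT.
have roL : ro <= (L - l) / 2 by rewrite !ge_min lexx orbT.
have inL x : l - ro <= x <= l + ro -> x < L by clear -roL lL; lra.
(* Near [l], on both sides, noncontact at time [ta] persists because [y] is nondecreasing in time;
   so [D] is a supersolution there from [ta] on. *)
have nc x t : l - ro <= x <= l + ro -> ta <= t <= T -> psi x < y (x, t).
  move=> hx ht; have := H2 x.
  have -> : `|x - l| <= d2 by rewrite ler_norml; clear -hx ro2; lra.
  move=> /(_ isT); rewrite (psic l (lexx l)) ler_norml => /andP[k1 _].
  have : y (x, ta) <= y (x + 0, ta + (t - ta)).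
    apply: mono; first by clear -ht ta0; lra.
      by rewrite subr0; apply: ltW; exact: inL.
    by clear -ht ta0; lra.
  rewrite addr0 addrC subrK.
  by move: k1; clear -yta; lra.
have Dl : forall t, ta <= t <= s1 + h -> 0 < D (l, t).
  apply: (@positivity_propagates R s b r l ro ta (s1 + h) (D (l, ta) / 2) D) => //.
  - exact: ltW.
  - by rewrite divr_gt0.
  - move=> x t hx ht; apply: sD; first by apply: inL; clear -hx; lra.
      by clear -ht ta0 t1E t1T; lra.
    by apply: nc; [clear -hx; lra|clear -ht t1E t1T h0; lra].
  - move=> x t hx ht; apply: D0; first by apply: ltW; exact: inL.
    by clear -ht ta0 t1E t1T; lra.
  move=> x hx; have := H1 x.
  have -> : `|x - l| <= d1 by rewrite ler_norml; clear -hx ro1; lra.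
  by move=> /(_ isT); rewrite ler_norml; clear; lra.
(* A single positive lower bound for [D] at [l] over all the times that the Hopf barrier looks
   at. *)
have [tm + Hm] := EVT_min (f := fun t => D (l, t)) (a := s1) (b := s1 + h)
  ltac:(by rewrite lerDl ltW) (continuous_subspaceT (continuous_slice (x := l) cD)).
rewrite in_itv/= => htm.
pose m := D (l, tm).
have m0 : 0 < m by apply: Dl; clear -htm tas; lra.
have th0 : 0 < h / 2 by rewrite divr_gt0.
have [ka ka0 Hka] := linear_growth_at_left_end b s0 r0 al th0 m0.
(* The barrier needs a past of length [h / 2], hence the upper half of the time range; the slope
   [ka] is the same for all these [t2]. *)
have grow t2 x : s1 + h / 2 <= t2 <= s1 + h -> a <= x <= l -> ka * (x - a) <= D (x, t2).
  move=> ht2; apply: Hka => //.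
  - move=> x' t hx' ht; apply: sD; first by clear -hx' lL; lra.
      by clear -ht ht2 s10 t1E t1T h0; lra.
    rewrite psic; last by clear -hx'; lra.
    by apply: ygt; [clear -hx'; lra|clear -ht ht2 t1E h0; lra].
  - move=> x' t hx' ht; apply: D0; first by clear -hx' lL; lra.
    by clear -ht ht2 s10 t1E t1T h0; lra.
  by move=> t ht; apply: Hm; rewrite in_itv/=; clear -ht ht2; lra.
pose rk := Num.min (h / 2) (l - a).
have rk0 : 0 < rk by rewrite lt_min th0 subr_gt0.
have rk1 : rk <= h / 2 by rewrite ge_min lexx.
have rk2 : rk <= l - a by rewrite ge_min lexx orbT.
have aL : a < L by apply: lt_trans al lL.
have yge x t : x <= L -> 0 <= t <= T -> c <= y (x, t).
  by move=> hx ht; apply: (le_trans (psige x)); exact: (os_ge os).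
have yge' x t : box (a - rk) (a + rk) (t1 - rk) t1 (x, t) -> c <= y (x, t).
  rewrite /box/= => hb; apply: yge; first by clear -hb rk2 lL; lra.
  by clear -hb rk1 t1E h0 t1T s10; lra.
have ht1 : 0 < t1 <= T by clear -s10 st1 t1T; lra.
apply: (no_convex_kink s0 (ltW r0) ka0 rk0 cy (os_super os aL ht1)).
- by apply: yac; rewrite lexx (ltW st1).
- exact: yge'.
move=> x t hb.
have [ax|/ltW xa] := leP a x; last first.
  apply: le_trans (yge' _ _ hb); rewrite gerDl mulr_ge0_le0//; first exact: ltW.
  by clear -xa; lra.
move: hb; rewrite /box/= => hb.
(* Here [y (x, t)] equals [y (x, t - h) + D (x, t - h)], which is at least [c + ka * (x - a)]. *)
have := grow (t - h) x; rewrite DE subrK.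
have -> : (s1 + h / 2 <= t - h <= s1 + h) by clear -hb t1E rk1; lra.
have -> : (a <= x <= l) by clear -hb ax rk2; lra.
move=> /(_ isT isT).
have : c <= y (x, t - h).
  by apply: yge; [clear -hb rk2 lL; lra|clear -hb rk1 t1E h0 t1T s10; lra].
by clear; lra.
Qed.

(** * Strong solutions *)

Lemma continuous_psi1 (R : realType) (K1 k1 K2 : R) : continuous (psi1 K1 k1 K2).
Proof.
move=> x; rewrite /psi1.
have c1 : (fun x : R => expR x - K1) @ x --> expR x - K1.
  by apply: cvgB; [exact: continuous_expR|exact: cvg_cst].
have c2 : (fun x : R => Num.max (expR x - K1) 0) @ x --> Num.max (expR x - K1) 0.
  rewrite (_ : (fun x => _) = (fun x : R => (expR x - K1 + 0 + `|expR x - K1 - 0|) / 2)); last first.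
    by apply/funext => u; rewrite numfield.Num.Theory.maxr_absE.
  rewrite numfield.Num.Theory.maxr_absE; apply: cvgMl.
  apply: cvgD; first by apply: cvgD; [exact: c1|exact: cvg_cst].
  by apply: cvg_norm; apply: cvgB; [exact: c1|exact: cvg_cst].
apply: cvgB; last exact: cvg_cst.
by apply: cvgD; [exact: c2|exact: cvg_cst].
Qed.

Lemma psi1_homo (R : realType) (K1 k1 K2 : R) : {homo psi1 K1 k1 K2 : x x' / x <= x'}.
Proof.
move=> x x' xx'; rewrite /psi1 lerD2r lerD2r ge_max !le_max lexx orbT andbT.
by rewrite lerD2r ler_expR xx'.
Qed.

Lemma psi1_le (R : realType) (K1 k1 K2 x : R) : 0 < K1 -> x <= ln K1 ->
  psi1 K1 k1 K2 x = K2 - k1.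
Proof.
move=> K10 xl; rewrite /psi1 max_r ?add0r// subr_le0.
by rewrite -[leRHS](lnK (x := K1)) ?posrE// ler_expR.
Qed.

(** The tangent to exp(x) - K1 at ln K1 has slope [K1], which is the slope of the kink. *)
Lemma psi1_ge (R : realType) (K1 k1 K2 x : R) : 0 < K1 ->
  K2 - k1 + K1 * (x - ln K1) <= psi1 K1 k1 K2 x.
Proof.
move=> K10.
have -> : psi1 K1 k1 K2 x = K2 - k1 + Num.max (expR x - K1) 0 by rewrite /psi1; ring.
rewrite lerD2l le_max; apply/orP; left.
have -> : expR x = K1 * expR (x - ln K1).
  by rewrite expRB lnK ?posrE// mulrC divfK// gt_eqF.
have : K1 * (1 + (x - ln K1)) <= K1 * expR (x - ln K1).
  by apply: ler_wpM2l; [exact: ltW|exact: expR_ge1Dx].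
by clear; lra.
Qed.

Lemma psi1_top (R : realType) (K1 k1 K2 : R) : 0 < K1 -> K1 < k1 ->
  psi1 K1 k1 K2 (ln k1) = K2 - K1.
Proof.
move=> K10 K1k1; rewrite /psi1 lnK ?posrE ?(lt_trans K10)// max_l ?subr_ge0 ?(ltW K1k1)//.
ring.
Qed.

Lemma weak_derivative_eq (R : realType) (U : set (R * R)) (v : R * R)
    (u u' g : R * R -> R) : (forall z, U z -> u z = u' z) ->
  weak_derivative U v u g -> weak_derivative U v u' g.
Proof.
move=> uu' [lu lg W]; split=> //.
  move=> K cK KU; have /integrableP[mu iu] := lu K cK KU; apply/integrableP; split.
    by apply: eq_measurable_fun mu => z; rewrite inE => /KU/uu' /= ->.
  rewrite (_ : (\int[_]_(_ in _) _)%E = (\int[lebesgue2 R]_(x in K) `|(EFin \o u) x|)%E)//.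
  by apply: eq_integral => z; rewrite inE => /KU/uu' /= ->.
move=> phi tphi; rewrite -(W _ tphi); apply: eq_Rintegral => z; rewrite inE => Uz.
by rewrite uu'.
Qed.

(* A strong solution is arbitrary outside [Qclosed]; composing it with the
   retraction onto [Qclosed] makes it continuous on the whole plane. *)
Definition clamp (R : realType) (L T : R) (z : R * R) : R * R :=
  (Num.min z.1 L, Num.max 0 (Num.min z.2 T)).

Lemma clamp_in (R : realType) (k1 T : R) z : 0 <= T -> Qclosed k1 T (clamp (ln k1) T z).
Proof.
move=> T0; split; rewrite /clamp/= in_itv/=; first by rewrite ge_min lexx orbT.
by rewrite le_max lexx/= ge_max T0/= ge_min lexx orbT.
Qed.

Lemma clamp_id (R : realType) (L T x t : R) : x <= L -> 0 <= t <= T ->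
  clamp L T (x, t) = (x, t).
Proof.
move=> xL /andP[t0 tT]; rewrite /clamp/= min_l// min_l// max_r//.
Qed.

Lemma continuous_clamp (R : realType) (L T : R) : continuous (@clamp R L T).
Proof.
move=> z.
have mn (f g : R * R -> R) a b : f @ z --> a -> g @ z --> b ->
    (fun w => Num.min (f w) (g w)) @ z --> Num.min a b.
  move=> fa gb; rewrite (_ : (fun w => _) = (fun w => (f w + g w - `|f w - g w|) / 2)); last first.
    by apply/funext => u; rewrite numfield.Num.Theory.minr_absE.
  rewrite numfield.Num.Theory.minr_absE; apply: cvgMl; apply: cvgB; first exact: cvgD.
  by apply: cvg_norm; exact: cvgB.
have mx (f g : R * R -> R) a b : f @ z --> a -> g @ z --> b ->
    (fun w => Num.max (f w) (g w)) @ z --> Num.max a b.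
  move=> fa gb; rewrite (_ : (fun w => _) = (fun w => (f w + g w + `|f w - g w|) / 2)); last first.
    by apply/funext => u; rewrite numfield.Num.Theory.maxr_absE.
  rewrite numfield.Num.Theory.maxr_absE; apply: cvgMl; apply: cvgD; first exact: cvgD.
  by apply: cvg_norm; exact: cvgB.
have c1 : (fun w : R * R => Num.min w.1 L) @ z --> Num.min z.1 L.
  by apply: mn; [exact: cvg_fst|exact: cvg_cst].
have c2 : (fun w : R * R => Num.max 0 (Num.min w.2 T)) @ z --> Num.max 0 (Num.min z.2 T).
  by apply: mx; [exact: cvg_cst|apply: mn; [exact: cvg_snd|exact: cvg_cst]].
exact: (cvg_pair c1 c2).
Qed.

Lemma continuous_comp_within (R : realType) (A : set (R * R)) (Y : R * R -> R)
    (f : R * R -> R * R) :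
  {within A, continuous Y} -> continuous f -> (forall z, A (f z)) -> continuous (Y \o f).
Proof.
move=> /subspace_continuousP cY cf Af z.
have h : f @ z --> within A (nbhs (f z)).
  move=> B /= hB; have H : nbhs z (f @^-1` [set x | A x -> B x]) := cf z _ hB.
  change (nbhs z (f @^-1` B)).
  by apply: filterS H => w /= h; exact: (h (Af w)).
exact: (cvg_comp _ _ h (cY _ (Af z))).
Qed.

Lemma strong_solution_obstacle (R : realType) (K1 k1 K2 sigma r q T p : R) (Y : R * R -> R) :
  0 < K1 -> K1 < k1 -> 0 < T ->
  strong_solution K1 k1 K2 sigma r q T p Y -> bounded_solution k1 T Y ->
  exists M, obstacle_solution (sigma ^+ 2 / 2) (r - q - sigma ^+ 2 / 2) r (ln k1) T M
    (psi1 K1 k1 K2) (Y \o clamp (ln k1) T).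
Proof.
move=> K10 K1k1 T0 [Yx [Yxx [Yt [[cY Wx Wxx Wt _] [Yge Ysup Yeq Yinit Ybdry]]]]] [M hM].
exists M.
pose L := ln k1; pose y := Y \o clamp L T.
have cy : continuous y.
  apply: continuous_comp_within cY (@continuous_clamp R L T) _ => z.
  by apply: clamp_in; exact: ltW.
have yE x t : x <= L -> 0 <= t <= T -> y (x, t) = Y (x, t).
  by move=> xL ht; rewrite /y/= clamp_id.
have yQ z : Qint k1 T z -> Y z = y z.
  case: z => x t [/=]; rewrite !in_itv/= => xL /andP[t0 tT].
  by rewrite yE// ?(ltW xL)// (ltW t0) (ltW tT).
(* At the corner [x = L] the value comes from the lateral condition, which agrees with the obstacle
   by [psi1_top]. *)
have init x : x <= L -> y (x, 0) = psi1 K1 k1 K2 x.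
  rewrite le_eqVlt => /predU1P[->|xL].
    by rewrite yE ?lexx ?(ltW T0)// Ybdry ?lexx ?(ltW T0)// psi1_top.
  by rewrite yE ?(ltW xL) ?lexx ?(ltW T0)// Yinit.
have bdry t : 0 <= t <= T -> y (L, t) = psi1 K1 k1 K2 L.
  by move=> ht; rewrite yE// Ybdry// psi1_top.
have Uin x0 t0 rho : x0 + 2 * rho < L -> 0 < t0 - 2 * rho -> t0 <= T -> forall z : R * R,
    x0 - 2 * rho <= z.1 <= x0 + 2 * rho -> t0 - 2 * rho <= z.2 < t0 -> Qint k1 T z.
  move=> h1 h2 h3 [x t] /= h4 h5; split; rewrite /= in_itv/=.
    by rewrite -/L; clear -h1 h4; lra.
  by clear -h2 h3 h5; lra.
have QQ z : Qint k1 T z -> Qdom k1 T z.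
  by case: z => x t [/= h1]; rewrite !in_itv/= in h1 * => /andP[h2 /ltW h3]; split; rewrite /= in_itv/= ?h2.
have Lop_E z : Qint k1 T z -> Yt z - Lop sigma r q (Y z) (Yx z) (Yxx z) =
    Yt z - sigma ^+ 2 / 2 * Yxx z - (r - q - sigma ^+ 2 / 2) * Yx z + r * y z.
  by move=> Qz; rewrite -yQ// /Lop; ring.
have Wx' := weak_derivative_eq yQ Wx.
have Wt' := weak_derivative_eq yQ Wt.
split => //.
- by move=> z; apply: hM; apply: clamp_in; exact: ltW.
- move=> x t; rewrite le_eqVlt => /predU1P[->|xL] ht; first by have := bdry t ht; rewrite /y/= => ->.
  have [t0|tn0] := ltP 0 t.
    have := yE x t (ltW xL) ht; rewrite /y/= => ->; apply: (Yge (x, t)); split; rewrite /= in_itv//= t0.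
    by case/andP: ht.
  have -> : t = 0 by apply/eqP; rewrite eq_le tn0; case/andP: ht.
  by have := init x (ltW xL); rewrite /y/= => ->.
- move=> x t; rewrite -/L => xL /andP[t0 tT].
  (* Quarters, because [heat_approx_weak] uses a box of twice this radius, which must lie in the
     interior. *)
  pose rho := Num.min ((L - x) / 4) (t / 4).
  have rho0 : 0 < rho by rewrite lt_min !divr_gt0// subr_gt0.
  have rho1 : rho <= (L - x) / 4 by rewrite ge_min lexx.
  have rho2 : rho <= t / 4 by rewrite ge_min lexx orbT.
  have hU := Uin x t rho ltac:(clear -rho1 xL; lra) ltac:(clear -rho2 t0; lra) tT.
  apply: (heat_approx_weak (or_introl erefl) cy Wx' Wxx Wt' rho0 hU).
  have [Z [mZ Z0 hZ]] := Ysup; exists Z; split => //; apply: subset_trans hZ => z.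
  apply: contra_not => hz h1 h2; have Qz := hU z h1 h2.
  by rewrite -Lop_E//; apply: hz; exact: QQ.
move=> x t; rewrite -/L => xL /andP[t0 tT] hlt.
have cyp : continuous (fun z : R * R => y z - psi1 K1 k1 K2 z.1).
  move=> z; apply: (@continuousB _ _ _ y (fun z => psi1 K1 k1 K2 z.1) z (cy z)).
  by apply: continuous_comp; [exact: cvg_fst|exact: continuous_psi1].
have e0 : 0 < (y (x, t) - psi1 K1 k1 K2 x) / 2 by rewrite divr_gt0// subr_gt0.
have [d d0 Hd] := compact_uniform_continuity (@compact_set1 _ ((x, t) : R * R)) cyp e0.
(* The bound [d / 2] keeps the doubled box inside the region where continuity preserves
   [y > psi1]. *)
pose rho := Num.min (d / 2) (Num.min ((L - x) / 4) (t / 4)).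
have rho0 : 0 < rho by rewrite !lt_min !divr_gt0// subr_gt0.
have rho1 : rho <= (L - x) / 4 by rewrite !ge_min lexx orbT.
have rho2 : rho <= t / 4 by rewrite !ge_min lexx !orbT.
have rhod : rho <= d / 2 by rewrite !ge_min lexx.
have hU := Uin x t rho ltac:(clear -rho1 xL; lra) ltac:(clear -rho2 t0; lra) tT.
apply: (heat_approx_weak (or_intror erefl) cy Wx' Wxx Wt' rho0 hU).
have [Z [mZ Z0 hZ]] := Yeq; exists Z; split => //; apply: subset_trans hZ => z.
apply: contra_not => hz h1 h2; have Qz := hU z h1 h2.
rewrite -Lop_E//; apply: hz; first exact: QQ.
have := Hd (x, t) z erefl.
have -> : `|z.1 - x| <= d by rewrite ler_norml; clear -h1 rhod; lra.
have -> : `|z.2 - t| <= d by rewrite ler_norml; clear -h2 rhod rho0; lra.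
move=> /(_ isT isT); rewrite yQ// ler_norml /= => /andP[+ _].
by clear -hlt; rewrite /y/= in hlt *; lra.
Qed.

Theorem theorem4p4 (R : realType) (K1 k1 k2 K2 sigma r q T p : R)
    (Y : R * R -> R) (A : R -> R)
    (hK1 : 0 < K1) (hK1k1 : K1 < k1) (hk1k2 : k1 < k2) (hk2K2 : k2 < K2)
    (hsigma : 0 < sigma) (hr : 0 < r) (hq : 0 <= q) (hT : 0 < T)
    (hp : 1 < p)
    (hY : strong_solution K1 k1 K2 sigma r q T p Y)
    (hYbounded : bounded_solution k1 T Y)
    (hA : forall tau, 0 < tau <= T ->
            is_max (lower_contact_set K1 k1 K2 Y tau) (A tau))
    (hA0 : A 0 = lim (A tau @[tau --> 0^'+])) :
  [/\ {in `[0, T] &, forall s t, s < t -> A t < A s},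
      {within `[0, T], continuous A},
      A tau @[tau --> 0^'+] --> ln K1 &
      A 0 = ln K1].
Proof.
have [M os] := strong_solution_obstacle hK1 hK1k1 hT hY hYbounded.
set y := Y \o clamp (ln k1) T in os.
set s := sigma ^+ 2 / 2 in os; set b := r - q - s in os.
set L := ln k1 in y os *; set psi := psi1 K1 k1 K2 in os.
pose l := ln K1; pose c := K2 - k1.
have s0 : 0 < s by rewrite divr_gt0// exprn_gt0.
have lL : l < L by rewrite ltr_ln ?posrE// (lt_trans hK1).
have c0 : 0 < c by rewrite /c; clear -hk1k2 hk2K2; lra.
have npsi : {homo psi : x x' / x <= x'} := @psi1_homo R K1 k1 K2.
have psic x : x <= l -> psi x = c by exact: psi1_le.
have psik x : l <= x -> c + K1 * (x - l) <= psi x by move=> _; exact: psi1_ge.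
have cpsi : continuous psi := @continuous_psi1 R K1 k1 K2.
have psige x : c <= psi x.
  have [/psic->//|/ltW lx] := leP x l.
  by rewrite -(psic l) ?lexx// npsi.
have psiL0 : 0 <= psi L by apply: le_trans (psige L); exact: ltW.
have cy : continuous y := os_cont os.
have yge x t : x <= L -> 0 <= t <= T -> c <= y (x, t).
  by move=> hx ht; apply: (le_trans (psige x)); exact: (os_ge os).
have kink := obstacle_solution_gt_kink s0 (ltW hr) hK1 lL npsi os psic psik.
have mono h k := obstacle_solution_mono (h := h) (k := k) (ltW s0) (ltW hr) psiL0 npsi os.
have lxL x : x <= l -> x <= L by move=> /le_trans; apply; exact: ltW.
have yY x t : x <= l -> 0 < t <= T -> y (x, t) = Y (x, t).
  move=> /lxL xL /andP[t0 tT]; rewrite /y/= clamp_id//.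
  by rewrite (ltW t0).
have Al t : 0 < t <= T -> A t <= l by move=> /hA[[]].
have yA t : 0 < t <= T -> y (A t, t) = c.
  by move=> ht; rewrite yY ?Al//; have [[]] := hA t ht.
have Amax t x : 0 < t <= T -> x <= l -> y (x, t) = c -> x <= A t.
  by move=> ht xl yc; have [_] := hA t ht; apply; split=> //; rewrite -yY.
have Altl t : 0 < t <= T -> A t < l.
  move=> ht; rewrite lt_neqAle Al// andbT; apply/eqP => E.
  by have := kink t ht; rewrite -E yA// ltxx.
have ygt x t : 0 < t <= T -> x <= l -> A t < x -> c < y (x, t).
  move=> ht xl Ax; rewrite lt_neqAle yge ?lxL//; last first.
    by case/andP: ht => /ltW -> ->.
  rewrite andbT eq_sym; apply/eqP => /(Amax t x ht xl).
  by rewrite leNgt Ax.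
(* Monotonicity in x bounds [y (x, t)] by its value [c] at [A t]. *)
have contact t x : 0 < t <= T -> x <= A t -> y (x, t) = c.
  move=> ht xA; have ht' : 0 <= t <= T by case/andP: ht => /ltW -> ->.
  apply: le_anti; rewrite yge ?andbT//; last by apply: lxL; exact: le_trans (Al t ht).
  rewrite -(yA t ht).
  have E : x + (A t - x) = A t by ring.
  have := mono (A t - x) 0; rewrite subr_ge0 lexx (ltW hT) => /(_ xA isT x t).
  rewrite E addr0 subr0; apply=> //.
  by have := lxL _ (Al t ht); clear; lra.
have Amono u t : 0 < u -> u < t -> t <= T -> A t <= A u.
  move=> u0 ut tT.
  have ht : 0 < t <= T by rewrite tT (lt_trans u0).
  have hu : 0 < u <= T by rewrite u0 (le_trans (ltW ut)).
  apply: Amax => //; first exact: Al.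
  apply: le_anti; rewrite yge ?andbT//.
  - rewrite -[X in _ <= X](yA t ht).
    have E : u + (t - u) = t by ring.
    have := mono 0 (t - u) (lexx 0) _ (A t) u; rewrite addr0 E; apply.
    + by clear -u0 ut tT; lra.
    + by rewrite subr0; exact: lxL (Al t ht).
    by clear -u0 ut tT; lra.
  - exact: lxL (Al t ht).
  by case/andP: hu => /ltW -> ->.
have Astrict u t : 0 < u -> u < t -> t <= T -> A t < A u.
  move=> u0 ut tT; rewrite lt_neqAle Amono// andbT; apply/eqP => E.
  have ht : 0 < t <= T by rewrite tT (lt_trans u0).
  (* Equal values of the nonincreasing [A] at [u] and [t] force it to be constant in between, a
     vertical piece of boundary. *)
  have Ac v : u <= v <= t -> 0 < v <= T /\ A v = A t.
    move=> /andP[uv vt]; split; first by rewrite (lt_le_trans u0)// (le_trans vt).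
    apply: le_anti; apply/andP; split.
      rewrite E; have [->//|uv'] : u = v \/ u < v by apply/predU1P; rewrite -le_eqVlt.
      by apply: Amono => //; exact: le_trans vt tT.
    have [->//|vt'] : v = t \/ v < t by apply/predU1P; rewrite -le_eqVlt.
    by apply: Amono => //; exact: lt_le_trans uv.
  apply: (free_boundary_not_vertical s0 hr c0 hK1 lL npsi cpsi os psic psik (Altl t ht) u0 ut tT).
    by move=> v /Ac[hv <-]; exact: yA.
  by move=> x v /andP[Ax xl] /Ac[hv Av]; apply: ygt => //; rewrite Av.
(* Stated for a general [a] so that it covers [t0 = 0], where contact along the initial condition
   reaches [a = l], as well as right continuity with [a = A t0]. *)
have right t0 a e : 0 <= t0 < T -> a <= l -> (forall x, x <= a -> y (x, t0) = c) -> 0 < e ->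
    exists t1, t0 < t1 <= T /\ a - e < A t1.
  move=> /andP[t00 t0T] al yc e0; apply: contrapT => H.
  have An t : t0 < t <= T -> A t <= a - e.
    by move=> ht; rewrite leNgt; apply/negP => h; apply: H; exists t.
  apply: (contact_persists (ltW s0) hr c0 os (x1 := a - e) (x2 := a) (t0 := t0) (t1 := T)) => //.
  - by clear -e0; lra.
  - exact: lxL.
  - by move=> x /andP[_ xa]; apply: psic; exact: le_trans al.
  - by move=> x /andP[_ xa]; exact: yc.
  move=> x t /andP[ax xa] ht; apply: ygt.
  - by case/andP: ht => h ->; rewrite (le_lt_trans t00).
  - by apply: le_trans al; exact: ltW.
  - exact: le_lt_trans (An t ht) ax.
(* Otherwise [A t0 + e] would be a contact point at all earlier times, hence by continuity at [t0],
   beyond the maximum [A t0]. *)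
have left t0 e : 0 < t0 <= T -> 0 < e -> exists t1, 0 < t1 < t0 /\ A t1 < A t0 + e.
  move=> ht0 e0; apply: contrapT => H.
  have An t : 0 < t < t0 -> A t0 + e <= A t.
    by move=> ht; rewrite leNgt; apply/negP => h; apply: H; exists t.
  have t00 : 0 < t0 by case/andP: ht0.
  have in0 t : 0 < t < t0 -> 0 < t <= T.
    by case/andP: ht0 => _ h /andP[-> /ltW h']; rewrite (le_trans h').
  have al : A t0 + e <= l.
    have hh : 0 < t0 / 2 < t0 by clear -t00; lra.
    by apply: (le_trans (An _ hh)); apply: Al; exact: in0.
  have yc : c < y (A t0 + e, t0) by apply: ygt => //; rewrite ltrDl.
  have [d d0 Hd] := continuous_near_le t0 (continuous_slice (x := A t0 + e) cy)
    (e := (y (A t0 + e, t0) - c) / 2) ltac:(by rewrite divr_gt0// subr_gt0).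
  pose t := Num.max (t0 / 2) (t0 - d).
  have tt0 : t < t0 by rewrite gt_max; clear -t00 d0; lra.
  have t0t : 0 < t by rewrite lt_max divr_gt0.
  have td : t0 - d <= t by rewrite le_max lexx orbT.
  have ht : 0 < t < t0 by rewrite t0t.
  have := Hd t; rewrite (contact t (A t0 + e) (in0 t ht) (An t ht)).
  have -> : `|t - t0| <= d by rewrite ler_norml; clear -td tt0 d0; lra.
  by move=> /(_ isT); rewrite ler_norml; clear -yc; lra.
have cvgA : A tau @[tau --> 0^'+] --> l.
  apply/cvgrPdist_le => e e0.
  have [||t1 [/andP[t10 t1T] At1]] := right 0 l e _ (lexx l) _ e0.
  - by rewrite lexx.
  - by move=> x xl; rewrite (os_init os) ?psic// lxL.
  near=> t.
  have t0 : 0 < t by near: t; exact: nbhs_right_gt.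
  have tt1 : t < t1 by near: t; exact: nbhs_right_lt.
  have := Amono t t1 t0 tt1 t1T.
  have := Al t; rewrite t0 (le_trans (ltW tt1) t1T) => /(_ isT).
  by rewrite ler_norml; clear -At1 e0; lra.
have A0 : A 0 = l by rewrite hA0; exact: cvg_lim cvgA.
have anti u t : 0 <= u -> u < t -> t <= T -> A t < A u.
  move=> u00; have [<- t0 tT|u0] : 0 = u \/ 0 < u by apply/predU1P; rewrite -le_eqVlt.
    by rewrite A0 Altl// t0.
  exact: Astrict.
split=> //.
  move=> u t; rewrite !in_itv/= => /andP[u0 _] /andP[_ tT] ut.
  exact: anti.
apply/subspace_continuousP => t0; rewrite /= in_itv/= => /andP[t00 t0T].
apply/cvgrPdist_le => e e0.
(* Monotonicity gives two of the four one-sided bounds; [right] supplies the lower bound after [t0],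
   vacuous at [T], and [left] the upper bound before [t0], vacuous at 0. *)
have [dr dr0 Hr] : exists2 d, 0 < d & forall t, t0 < t <= T -> t < t0 + d -> A t0 - e <= A t.
  have [t0lt|Tt0] := ltP t0 T; last first.
    by exists 1 => // t /andP[h1 h2]; clear -h1 h2 Tt0; lra.
  have yc x : x <= A t0 -> y (x, t0) = c.
    have [<-|t00'] : 0 = t0 \/ 0 < t0 by apply/predU1P; rewrite -le_eqVlt.
      by rewrite A0 => xl; rewrite (os_init os) ?psic// lxL.
    by apply: contact; rewrite t00'.
  have A0l : A t0 <= l.
    have [<-|t00'] : 0 = t0 \/ 0 < t0 by apply/predU1P; rewrite -le_eqVlt.
      by rewrite A0.
    by apply: Al; rewrite t00'.
  have [|t1 [/andP[t10 t1T] At1]] := right t0 (A t0) e _ A0l yc e0; first by rewrite t00.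
  exists (t1 - t0); first by rewrite subr_gt0.
  move=> t /andP[h1 h2] h3.
  have tt1 : t < t1 by clear -h3; lra.
  have := anti t t1 (le_trans t00 (ltW h1)) tt1 t1T.
  by clear -At1; lra.
have [dl dl0 Hl] : exists2 d, 0 < d & forall t, 0 <= t < t0 -> t0 - d < t -> A t <= A t0 + e.
  have [<-|t00'] : 0 = t0 \/ 0 < t0 by apply/predU1P; rewrite -le_eqVlt.
    by exists 1 => // t /andP[h1 h2]; clear -h1 h2; lra.
  have [|t1 [/andP[t10 t1t0] At1]] := left t0 e _ e0; first by rewrite t00'.
  exists (t0 - t1); first by rewrite subr_gt0.
  move=> t /andP[h1 h2] h3.
  have tt1 : t1 < t by clear -h3; lra.
  have := anti t1 t (ltW t10) tt1 (le_trans (ltW h2) t0T).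
  by clear -At1; lra.
near=> t.
have ht : 0 <= t <= T.
  have : [set` `[0, T]] t by near: t; exact: withinT.
  by rewrite /= in_itv.
have [h1 h2] : t0 - dl < t /\ t < t0 + dr.
  near: t; apply: (cvg_within); apply: filterI.
    by apply: lt_nbhsr; clear -dl0; lra.
  by apply: lt_nbhsl; clear -dr0; lra.
have [tt0|t0t|->] := ltgtP t t0.
- have := Hl t _ h1; have := anti t t0 _ tt0 t0T.
  case/andP: ht => -> _; rewrite tt0 => /(_ isT) g1 /(_ isT) g2.
  by change (`|A t0 - A t| <= e); rewrite ler_norml; clear -g1 g2 e0; lra.
- have := Hr t _ h2; have := anti t0 t t00 t0t.
  case/andP: ht => _ ->; rewrite t0t => /(_ isT) g1 /(_ isT) g2.
  by change (`|A t0 - A t| <= e); rewrite ler_norml; clear -g1 g2 e0; lra.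
by rewrite subrr normr0 ltW.
Unshelve. all: by end_near. Qed.
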